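(* Let $\Sigma$ be a closed Riemann surface of genus $\ge 1$. Let $G$ be a reductive complex algebraic group with abelianisation $A$, and assume $\dim A>0$. Let $\Gamma\subseteq\mathrm{Mod}(\Sigma)$ be a subgroup. Let $V\subseteq H_1(\Sigma,\mathbb{Z})$ be a proper symplectic subspace, and assume that the image of $\Gamma$ in $\mathrm{Sp}(H_1(\Sigma,\mathbb{Z}))$ under the homology representation is contained in $\mathrm{Sp}(V)\subseteq \mathrm{Sp}(H_1(\Sigma,\mathbb{Z}))$. Then $\mathbb{C}(\mathcal{X}_G(\Sigma))^{\Gamma}\neq\mathbb{C}$. As a consequence, the action of $\Gamma$ on $\mathcal{X}_G(\Sigma)$ has no Zariski dense orbits.
   Context: $\mathcal{X}_G(\Sigma)$ is the GIT quotient by conjugation of the affine variety $\mathcal{R}_G(\Sigma,* )$ of homomorphisms $\pi_1(\Sigma,* )\to G$; the mapping class group $\mathrm{Mod}(\Sigma)$ acts on it. $\mathbb{C}(\mathcal{X}_G(\Sigma))^\Gamma$ denotes the $\Gamma$-invariant rational functions. A symplectic subspace $V\subseteq H_1(\Sigma,\mathbb{Z})$ is a subgroup on which the intersection form is unimodular, so that $H_1(\Sigma,\mathbb{Z})=V\oplus V^\perp$; $\mathrm{Sp}(V)$ is regarded as the subgroup of $\mathrm{Sp}(H_1(\Sigma,\mathbb{Z}))$ of automorphisms preserving $V$ and acting as the identity on $V^\perp$. *)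

(* Defs.v *)
From HB Require Import structures.
From mathcomp Require Import all_boot all_order all_algebra.
From mathcomp Require Import freeg complex.
From mathcomp Require Import all_classical all_reals all_analysis.
From mathcomp Require Import ring lra.

Set Implicit Arguments.
Unset Strict Implicit.
Unset Printing Implicit Defensive.

Import Order.TTheory GRing.Theory Num.Theory.
Import numFieldNormedType.Exports.

Local Open Scope classical_set_scope.
Local Open Scope ring_scope.
Local Open Scope quotient_scope.

Section Glue.
Variables (R : realType) (S X : topologicalType).

Lemma continuous_glue (u : S -> R) (f g : S -> X) (c : R) :
    continuous u -> continuous f -> continuous g ->
    (forall s, u s = c -> f s = g s) ->
  continuous (fun s => if u s <= c then f s else g s).
Proof.
move=> cu cf cg fg s A /= As.
have [us|us|us] := ltgtP (u s) c.
- rewrite ltW // in As.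
  have H1 : \forall t \near s, u t < c by exact: (cvgr_lt _ (cu s)).
  have H2 : \forall t \near s, A (f t) by exact: cf.
  by apply: filterS2 H1 H2 => t ut Af; rewrite /preimage /= ltW.
- rewrite leNgt us /= in As.
  have H1 : \forall t \near s, c < u t by exact: (cvgr_gt _ (cu s)).
  have H2 : \forall t \near s, A (g t) by exact: cg.
  by apply: filterS2 H1 H2 => t ut Ag; rewrite /preimage /= leNgt ut.
- rewrite us lexx in As.
  have H1 : \forall t \near s, A (f t) by exact: cf.
  have H2 : \forall t \near s, A (g t) by apply: cg; rewrite -fg.
  by apply: filterS2 H1 H2 => t Af Ag; rewrite /preimage /=; case: ifP.
Qed.

End Glue.

Section Cts.
Variables (R : realType) (S : topologicalType).
Implicit Types f g : S -> R.

Lemma cts_cst (c : R) : continuous (fun _ : S => c).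
Proof. by move=> s; exact: cvg_cst. Qed.

Lemma cts_add f g : continuous f -> continuous g ->
  continuous (fun s => f s + g s).
Proof. by move=> cf cg s; exact: (cvgD (cf s) (cg s)). Qed.

Lemma cts_sub f g : continuous f -> continuous g ->
  continuous (fun s => f s - g s).
Proof. by move=> cf cg s; exact: (cvgB (cf s) (cg s)). Qed.

Lemma cts_mul f g : continuous f -> continuous g ->
  continuous (fun s => f s * g s).
Proof. by move=> cf cg s; exact: (cvgM (cf s) (cg s)). Qed.

Lemma cts_comp (X Y : topologicalType) (f : X -> Y) (g : S -> X) :
  continuous f -> continuous g -> continuous (fun s => f (g s)).
Proof. by move=> cf cg s; exact: (continuous_comp (cg s) (cf (g s))). Qed.

Lemma cts_id : continuous (fun s : S => s).
Proof. by move=> s; exact: cvg_id. Qed.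

Lemma cts_fst (X Y : topologicalType) : continuous (fun s : X * Y => s.1).
Proof. by move=> s; exact: cvg_fst. Qed.

Lemma cts_snd (X Y : topologicalType) : continuous (fun s : X * Y => s.2).
Proof. by move=> s; exact: cvg_snd. Qed.

Lemma cts_pair (X Y : topologicalType) (f : S -> X) (g : S -> Y) :
  continuous f -> continuous g -> continuous (fun s => (f s, g s)).
Proof. by move=> cf cg s; exact: (cvg_pair (cf s) (cg s)). Qed.

End Cts.

Local Ltac cts := repeat first [ exact: cts_cst | exact: cts_id | exact: cts_fst
  | exact: cts_snd | apply: cts_sub | apply: cts_add | apply: cts_mul
  | apply: cts_pair ].


(* A path is extended to the whole real line by its end points, so that no    *)
(* subspace topology is needed on the unit interval.                          *)
Record path (R : realType) (X : topologicalType) (x y : X) := Path {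
  path_fun :> R -> X;
  path_cts : continuous path_fun;
  path_le0 : forall t : R, t <= 0 -> path_fun t = x;
  path_ge1 : forall t : R, 1 <= t -> path_fun t = y }.

HB.instance Definition _ R X x y := gen_eqMixin (@path R X x y).
HB.instance Definition _ R X x y := gen_choiceMixin (@path R X x y).

Section Paths.
Variables (R : realType) (X : topologicalType).
Implicit Types x y z w : X.

Definition homotopic x y (p q : path R x y) : Prop :=
  exists H : R * R -> X, [/\ continuous H,
    forall t, H (0, t) = p t, forall t, H (1, t) = q t &
    forall s : R, 0 <= s <= 1 ->
      (forall t : R, t <= 0 -> H (s, t) = x) /\
      (forall t : R, 1 <= t -> H (s, t) = y)].

Lemma cst_path_cts x : continuous (fun _ : R => x).
Proof. by move=> t; exact: cvg_cst. Qed.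

Definition cst_path x : path R x x :=
  Path (@cst_path_cts x) (fun _ _ => erefl) (fun _ _ => erefl).

Lemma cat_path_cts x y z (p : path R x y) (q : path R y z) :
  continuous (fun t : R => if t <= 2^-1 then p (2 * t) else q (2 * t - 1)).
Proof.
apply: (@continuous_glue R R X id) => [t //|||s ->].
- by apply: cts_comp; [exact: path_cts|cts].
- by apply: cts_comp; [exact: path_cts|cts].
- by rewrite divff ?pnatr_eq0// subrr path_ge1 // path_le0.
Qed.

Lemma cat_path_le0 x y z (p : path R x y) (q : path R y z) t : t <= 0 ->
  (if t <= 2^-1 then p (2 * t) else q (2 * t - 1)) = x.
Proof. by move=> t0; rewrite ifT ?path_le0//; lra. Qed.

Lemma cat_path_ge1 x y z (p : path R x y) (q : path R y z) t : 1 <= t ->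
  (if t <= 2^-1 then p (2 * t) else q (2 * t - 1)) = z.
Proof. by move=> t1; rewrite ifF ?path_ge1//; lra. Qed.

Definition cat_path x y z (p : path R x y) (q : path R y z) : path R x z :=
  Path (@cat_path_cts _ _ _ p q) (@cat_path_le0 _ _ _ p q)
       (@cat_path_ge1 _ _ _ p q).

Lemma rev_path_cts x y (p : path R x y) : continuous (fun t : R => p (1 - t)).
Proof. by apply: cts_comp; [exact: path_cts|cts]. Qed.

Lemma rev_path_le0 x y (p : path R x y) (t : R) : t <= 0 -> p (1 - t) = y.
Proof. by move=> t0; apply: path_ge1; lra. Qed.

Lemma rev_path_ge1 x y (p : path R x y) (t : R) : 1 <= t -> p (1 - t) = x.
Proof. by move=> t0; apply: path_le0; lra. Qed.

Definition rev_path x y (p : path R x y) : path R y x :=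
  Path (@rev_path_cts _ _ p) (@rev_path_le0 _ _ p) (@rev_path_ge1 _ _ p).

Lemma homotopic_refl x y (p : path R x y) : homotopic p p.
Proof.
exists (fun st => p st.2); split=> //=.
- by apply: cts_comp; [exact: path_cts|cts].
- by move=> s _; split=> t t01; [exact: path_le0|exact: path_ge1].
Qed.

Lemma homotopic_sym x y (p q : path R x y) : homotopic p q -> homotopic q p.
Proof.
move=> [H [cH H0 H1 Hb]]; exists (fun st => H (1 - st.1, st.2)); split=> /=.
- by apply: cts_comp => //; cts.
- by move=> t; rewrite subr0 H1.
- by move=> t; rewrite subrr H0.
- by move=> s s01; apply: Hb; lra.
Qed.

Lemma homotopic_trans x y (p q r : path R x y) :
  homotopic p q -> homotopic q r -> homotopic p r.
Proof.
move=> [H [cH H0 H1 Hb]] [K [cK K0 K1 Kb]].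
exists (fun st => if st.1 <= 2^-1 then H (2 * st.1, st.2)
                  else K (2 * st.1 - 1, st.2)); split=> /=.
- apply: (@continuous_glue R (R * R)%type X fst); first by cts.
  + by apply: cts_comp => //; cts.
  + by apply: cts_comp => //; cts.
  + by move=> [s t] /= ->; rewrite divff ?pnatr_eq0// subrr H1 K0.
- by move=> t; rewrite ifT ?mulr0 ?H0//; lra.
- move=> t; rewrite ifF; last by lra.
  by rewrite (_ : 2 * 1 - 1 = 1 :> R) ?K1//; lra.
- by move=> s s01; have [s2|s2] := lerP s 2^-1; [apply: Hb|apply: Kb]; lra.
Qed.

Lemma homotopic_cat x y z (p p' : path R x y) (q q' : path R y z) :
  homotopic p p' -> homotopic q q' ->
  homotopic (cat_path p q) (cat_path p' q').
Proof.
move=> [H [cH H0 H1 Hb]] [K [cK K0 K1 Kb]].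
pose c (s : R) : R := Num.max 0 (Num.min 1 s).
have cc : continuous c.
  rewrite /c => s; apply: continuous_max; first exact: cst_continuous.
  by apply: continuous_min; [exact: cst_continuous|exact: cvg_id].
have c01 s : 0 <= c s <= 1.
  by rewrite /c le_max lexx /= ge_max ler01 ge_min lexx.
have cE s : 0 <= s <= 1 -> c s = s.
  by move=> /andP[s0 s1]; rewrite /c (min_idPr s1) (max_idPr s0).
exists (fun st => if st.2 <= 2^-1 then H (c st.1, 2 * st.2)
                  else K (c st.1, 2 * st.2 - 1)); split=> /=.
- apply: (@continuous_glue R (R * R)%type X snd); first by cts.
  + apply: cts_comp => //; apply: cts_pair; last by cts.
    by apply: cts_comp => //; cts.
  + apply: cts_comp => //; apply: cts_pair; last by cts.
    by apply: cts_comp => //; cts.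
  + move=> [s t] /= ->; rewrite divff ?pnatr_eq0// subrr.
    by rewrite (Hb _ (c01 s)).2 // (Kb _ (c01 s)).1.
- by move=> t; rewrite cE ?lexx ?ler01// H0 K0.
- by move=> t; rewrite cE ?lexx ?ler01// H1 K1.
- move=> s s01; split=> t ht.
  + by rewrite ifT ?(Hb _ (c01 s)).1//; lra.
  + by rewrite ifF ?(Kb _ (c01 s)).2//; lra.
Qed.

Lemma homotopic_rev x y (p q : path R x y) :
  homotopic p q -> homotopic (rev_path p) (rev_path q).
Proof.
move=> [H [cH H0 H1 Hb]]; exists (fun st => H (st.1, 1 - st.2)); split=> /=.
- by apply: cts_comp => //; cts.
- by move=> t; rewrite H0.
- by move=> t; rewrite H1.
- by move=> s s01; split=> t ht; [apply: (Hb _ s01).2|apply: (Hb _ s01).1]; lra.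
Qed.

Lemma homotopic_reparam x y (p p' q : path R x y) (u v : R -> R) :
    continuous u -> continuous v ->
    (forall t, t <= 0 -> u t <= 0 /\ v t <= 0) ->
    (forall t, 1 <= t -> 1 <= u t /\ 1 <= v t) ->
    (forall t, p t = q (u t)) -> (forall t, p' t = q (v t)) ->
  homotopic p p'.
Proof.
move=> cu cv uv0 uv1 pE p'E.
exists (fun st => q ((1 - st.1) * u st.2 + st.1 * v st.2)); split=> /=.
- apply: cts_comp; first exact: path_cts.
  apply: cts_add; apply: cts_mul; try by cts.
  + by apply: cts_comp => //; cts.
  + by apply: cts_comp => //; cts.
- by move=> t; rewrite subr0 mul1r mul0r addr0 pE.
- by move=> t; rewrite subrr mul1r mul0r add0r p'E.
- move=> s /andP[s0 s1]; split=> t ht.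
  + by have [ut vt] := uv0 t ht; apply: path_le0; nra.
  + by have [ut vt] := uv1 t ht; apply: path_ge1; nra.
Qed.

Lemma cat_cst_path x y (p : path R x y) : homotopic (cat_path (cst_path x) p) p.
Proof.
apply: (@homotopic_reparam _ _ _ _ p (fun t => 2 * t - 1) id) => //.
- by cts.
- by cts.
- by move=> t t0; split => //; lra.
- by move=> t t0; split => //; lra.
- by move=> t /=; case: ifP => // t2; rewrite path_le0//; lra.
Qed.

Lemma cat_path_cst x y (p : path R x y) : homotopic (cat_path p (cst_path y)) p.
Proof.
apply: (@homotopic_reparam _ _ _ _ p (fun t => 2 * t) id) => //.
- by cts.
- by cts.
- by move=> t t0; split => //; lra.
- by move=> t t0; split => //; lra.
- by move=> t /=; case: ifP => // t2; rewrite path_ge1//; lra.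
Qed.

Lemma cat_pathA x y z w (p : path R x y) (q : path R y z) (r : path R z w) :
  homotopic (cat_path p (cat_path q r)) (cat_path (cat_path p q) r).
Proof.
apply: homotopic_sym.
pose v (t : R) := if t <= 2^-1 then t + 4^-1 else (t + 1) / 2.
pose u (t : R) := if t <= 4^-1 then 2 * t else v t.
have cv : continuous v.
  apply: (@continuous_glue R R R id); [by cts|by cts|by cts|].
  by move=> t ->; lra.
have cu : continuous u.
  apply: (@continuous_glue R R R id); [by cts|by cts|by []|].
  by move=> t ->; rewrite /v ifT; lra.
apply: (@homotopic_reparam _ _ _ _ (cat_path p (cat_path q r)) u id) => //.
- by cts.
- by move=> t t0; split => //; rewrite /u ifT; lra.
- by move=> t t0; split => //; rewrite /u ifF /v ?ifF; lra.
- move=> t; rewrite /u /v /=.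
  case: (lerP t 2^-1) => t2.
    have -> : (2 * t <= 2^-1) = (t <= 4^-1) by apply/idP/idP => ?; lra.
    case: (lerP t 4^-1) => t4.
      by rewrite ifT; [congr (p _); lra|lra].
    rewrite ifF; last by lra.
    by rewrite ifT; [congr (q _); lra|lra].
  rewrite (_ : t <= 4^-1 = false); last by lra.
  rewrite ifF; last by lra.
  by rewrite ifF; [congr (r _); lra|lra].
Qed.

Lemma cat_path_rev x y (p : path R x y) :
  homotopic (cat_path p (rev_path p)) (cst_path x).
Proof.
pose u (t : R) := if t <= 2^-1 then 2 * t else 2 - 2 * t.
have cu : continuous u.
  apply: (@continuous_glue R R R id); [by cts|by cts|by cts|].
  by move=> t ->; lra.
apply: homotopic_sym; exists (fun st => p (st.1 * u st.2)); split=> /=.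
- apply: cts_comp; first exact: path_cts.
  by apply: cts_mul; [cts|apply: cts_comp => //; cts].
- by move=> t; rewrite mul0r path_le0.
- move=> t; rewrite mul1r /u; case: ifP => // _; congr (p _); lra.
- move=> s /andP[s0 s1]; split=> t ht; rewrite path_le0// /u.
  + by rewrite ifT; nra.
  + by rewrite ifF; nra.
Qed.

Lemma rev_pathK x y (p : path R x y) : homotopic p (rev_path (rev_path p)).
Proof.
apply: (@homotopic_reparam _ _ _ _ p id id) => //; [by cts|by cts|].
by move=> t /=; congr (p _); lra.
Qed.

Lemma cat_rev_path x y (p : path R x y) :
  homotopic (cat_path (rev_path p) p) (cst_path y).
Proof.
apply: homotopic_trans (cat_path_rev (rev_path p)).
by apply: homotopic_cat; [exact: homotopic_refl|exact: rev_pathK].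
Qed.

End Paths.

Section FundamentalGroup.
Variables (R : realType) (X : topologicalType) (x0 : X).

Definition homotopic_rel : rel (path R x0 x0) :=
  fun p q => `[< homotopic p q >].

Lemma homotopic_equiv : equiv_class_of homotopic_rel.
Proof.
split=> [p|p q|q p r].
- by apply/asboolP; exact: homotopic_refl.
- by apply/asboolP/asboolP; exact: homotopic_sym.
- by move=> /asboolP pq /asboolP qr; apply/asboolP; exact: homotopic_trans qr.
Qed.

Canonical homotopic_rel_equiv := EquivRelPack homotopic_equiv.
Canonical homotopic_rel_encMod := defaultEncModRel homotopic_rel.

Definition pi1 := {eq_quot homotopic_rel}.
HB.instance Definition _ := Choice.on pi1.
HB.instance Definition _ := EqQuotient.on pi1.

Definition pi1_class (p : path R x0 x0) : pi1 := \pi p.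

Lemma pi1_classP p q : pi1_class p = pi1_class q <-> homotopic p q.
Proof. by split=> [/eqmodP/asboolP|pq]; last exact/eqmodP/asboolP. Qed.

Lemma pi1_reprK a : pi1_class (repr a) = a.
Proof. exact: reprK. Qed.

Lemma pi1_ind (P : pi1 -> Prop) : (forall p, P (pi1_class p)) -> forall a, P a.
Proof. by move=> h a; rewrite -(pi1_reprK a). Qed.

Definition pi1_mul (a b : pi1) := pi1_class (cat_path (repr a) (repr b)).
Definition pi1_one := pi1_class (cst_path R x0).
Definition pi1_inv (a : pi1) := pi1_class (rev_path (repr a)).

Lemma repr_homotopic p : homotopic (repr (pi1_class p)) p.
Proof. by apply/pi1_classP; rewrite pi1_reprK. Qed.

Lemma pi1_mulE p q :
  pi1_mul (pi1_class p) (pi1_class q) = pi1_class (cat_path p q).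
Proof. by apply/pi1_classP/homotopic_cat; exact: repr_homotopic. Qed.

Lemma pi1_invE p : pi1_inv (pi1_class p) = pi1_class (rev_path p).
Proof. by apply/pi1_classP/homotopic_rev; exact: repr_homotopic. Qed.

Lemma pi1_mulA : associative pi1_mul.
Proof.
elim/pi1_ind=> p; elim/pi1_ind=> q; elim/pi1_ind=> r.
by rewrite !pi1_mulE; apply/pi1_classP/cat_pathA.
Qed.

Lemma pi1_mul1 : left_id pi1_one pi1_mul.
Proof.
by elim/pi1_ind=> p; rewrite pi1_mulE; apply/pi1_classP/cat_cst_path.
Qed.

Lemma pi1_mulr1 : right_id pi1_one pi1_mul.
Proof.
by elim/pi1_ind=> p; rewrite pi1_mulE; apply/pi1_classP/cat_path_cst.
Qed.

Lemma pi1_mulV : left_inverse pi1_one pi1_inv pi1_mul.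
Proof.
by elim/pi1_ind=> p; rewrite pi1_invE pi1_mulE; apply/pi1_classP/cat_rev_path.
Qed.

Lemma pi1_mulrV : right_inverse pi1_one pi1_inv pi1_mul.
Proof.
by elim/pi1_ind=> p; rewrite pi1_invE pi1_mulE; apply/pi1_classP/cat_path_rev.
Qed.

HB.instance Definition _ :=
  isGroup.Build pi1 pi1_mulA pi1_mul1 pi1_mulr1 pi1_mulV pi1_mulrV.

End FundamentalGroup.

Section InducedMap.
Variables (R : realType) (X Y : topologicalType) (f : continuousType X Y).

Lemma map_path_cts x y (p : path R x y) : continuous (fun t => f (p t)).
Proof. by apply: cts_comp; [exact: cts_fun|exact: path_cts]. Qed.

Lemma map_path_le0 x y (p : path R x y) (t : R) : t <= 0 -> f (p t) = f x.
Proof. by move=> t0; rewrite path_le0. Qed.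

Lemma map_path_ge1 x y (p : path R x y) (t : R) : 1 <= t -> f (p t) = f y.
Proof. by move=> t1; rewrite path_ge1. Qed.

Definition map_path x y (p : path R x y) : path R (f x) (f y) :=
  Path (@map_path_cts _ _ p) (@map_path_le0 _ _ p) (@map_path_ge1 _ _ p).

Lemma homotopic_map x y (p q : path R x y) :
  homotopic p q -> homotopic (map_path p) (map_path q).
Proof.
move=> [H [cH H0 H1 Hb]]; exists (fun st => f (H st)); split=> /=.
- by apply: cts_comp => //; exact: (@cts_fun _ _ f).
- by move=> t; rewrite H0.
- by move=> t; rewrite H1.
- by move=> s /Hb[h0 h1]; split=> t ht; [rewrite h0|rewrite h1].
Qed.

Lemma homotopic_map_cat x y z (p : path R x y) (q : path R y z) :
  homotopic (map_path (cat_path p q)) (cat_path (map_path p) (map_path q)).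
Proof.
apply: (@homotopic_reparam _ _ _ _ _ _ (map_path (cat_path p q)) id id) => //.
- exact: cts_id.
- exact: cts_id.
- by move=> t /=; case: ifP.
Qed.

(* The map [gamma] |-> [w . (f o gamma) . w^-1] on fundamental groups.        *)
Definition pi1_map (x0 : X) (y0 : Y) (w : path R y0 (f x0)) (a : pi1 R x0) :
    pi1 R y0 :=
  pi1_class (cat_path (cat_path w (map_path (repr a))) (rev_path w)).

Lemma pi1_mapE (x0 : X) (y0 : Y) (w : path R y0 (f x0)) (p : path R x0 x0) :
  pi1_map w (pi1_class p) =
  pi1_class (cat_path (cat_path w (map_path p)) (rev_path w)).
Proof.
apply/pi1_classP/homotopic_cat; last exact: homotopic_refl.
apply: homotopic_cat; first exact: homotopic_refl.
by apply: homotopic_map; exact: repr_homotopic.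
Qed.

Lemma pi1_mapM (x0 : X) (y0 : Y) (w : path R y0 (f x0)) (a b : pi1 R x0) :
  pi1_map w (a * b)%g = (pi1_map w a * pi1_map w b)%g.
Proof.
elim/pi1_ind: a => p; elim/pi1_ind: b => q.
rewrite [(_ * _)%g in LHS]pi1_mulE !pi1_mapE [RHS]pi1_mulE; apply/pi1_classP.
set u := map_path p; set v := map_path q; set w' := rev_path w.
have rfl := homotopic_refl; have cong := homotopic_cat.
have assoc := cat_pathA; have sym := homotopic_sym.
apply: (@homotopic_trans _ _ _ _ _
  (cat_path (cat_path w (cat_path u v)) w')).
  apply: (cong); last exact: rfl.
  by apply: (cong); [exact: rfl|exact: homotopic_map_cat].
apply: (@homotopic_trans _ _ _ _ _
  (cat_path (cat_path w u) (cat_path v w'))).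
  apply: (@homotopic_trans _ _ _ _ _
    (cat_path (cat_path (cat_path w u) v) w')).
    by apply: (cong); [exact: assoc|exact: rfl].
  exact/sym/assoc.
apply: (@homotopic_trans _ _ _ _ _
  (cat_path (cat_path w u) (cat_path w' (cat_path (cat_path w v) w')))).
  apply: (cong); first exact: rfl.
  apply: sym; apply: (@homotopic_trans _ _ _ _ _
    (cat_path (cat_path w' (cat_path w v)) w')); first exact: assoc.
  apply: (cong); last exact: rfl.
  apply: (@homotopic_trans _ _ _ _ _ (cat_path (cat_path w' w) v)).
    exact: assoc.
  apply: (@homotopic_trans _ _ _ _ _ (cat_path (cst_path R (f x0)) v)).
    by apply: (cong); [exact: cat_rev_path|exact: rfl].
  exact: cat_cst_path.
exact: assoc.
Qed.

End InducedMap.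

Section SingularHomology.
Variable R : realType.

Definition simplex n : set 'rV[R]_n.+1 :=
  [set t | (forall i, 0 <= t ord0 i) /\ \sum_i t ord0 i = 1].
Arguments simplex : clear implicits.

Definition face_fun n (i : 'I_n.+2) (t : 'rV[R]_n.+1) : 'rV[R]_n.+2 :=
  \row_j (if unlift i j is Some k then t ord0 k else 0).

Lemma face_fun_simplex n (i : 'I_n.+2) (t : set_type (simplex n)) :
  face_fun i (val t) \in simplex n.+1.
Proof.
case: t => t /= /set_mem[t0 t1]; apply/mem_set; split=> [j|].
  by rewrite mxE; case: unlift.
rewrite (bigD1_ord i)//= mxE unlift_none add0r -[RHS]t1.
by apply: eq_bigr => k _; rewrite mxE liftK.
Qed.

Definition face n (i : 'I_n.+2) (t : set_type (simplex n)) :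
  set_type (simplex n.+1) :=
  exist (fun u => u \in simplex n.+1) (face_fun i (val t))
    (face_fun_simplex i t).

Lemma face_fun_cts n (i : 'I_n.+2) : continuous (@face_fun n i).
Proof.
move=> t A [P tP PA].
exists (fun (a : 'I_1) k => [set s | P ord0 (fintype.lift i k) s]).
  by move=> a k; have := tP ord0 (fintype.lift i k); rewrite mxE liftK (ord1 a).
move=> s Ps; apply: PA => a j; rewrite mxE (ord1 a).
case: unliftP => [k ->|jE]; first exact: Ps.
by have := nbhs_singleton (tP ord0 j); rewrite mxE jE unlift_none.
Qed.

Lemma face_cts n (i : 'I_n.+2) : continuous (@face n i).
Proof.
apply: continuous_comp_initial.
apply: (@cts_comp _ _ _ (@face_fun n i) (@set_val _ (simplex n))).
  exact: face_fun_cts.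
exact: initial_continuous.
Qed.

HB.instance Definition _ n i :=
  isContinuous.Build _ _ (@face n i) (@face_cts n i).

Definition sing n (X : topologicalType) :=
  continuousType (set_type (simplex n)) X.
HB.instance Definition _ n X := Choice.on (sing n X).

Definition chain n X := {freeg (sing n X) / int}.
HB.instance Definition _ n X := GRing.Lmodule.on (chain n X).

Section Chains.
Variable X : topologicalType.

Definition boundary n (c : chain n.+1 X) : chain n X :=
  fglift (fun s : sing n.+1 X =>
    \sum_(i < n.+2) (-1) ^+ i *: << (s \o face i : sing n X) >>) c.

Lemma boundary_zmod n : zmod_morphism (@boundary n).
Proof. exact: lift_is_additive. Qed.

HB.instance Definition _ n :=
  GRing.isZmodMorphism.Build _ _ (@boundary n) (@boundary_zmod n).

Definition is_cycle : {pred chain 1 X} := fun c => boundary c == 0.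

Lemma is_cycle_closed : zmod_closed is_cycle.
Proof.
split=> [|x y]; rewrite /is_cycle !unfold_in ?raddf0//.
by move=> /eqP x0 /eqP y0; rewrite raddfB /= x0 y0 subrr.
Qed.

HB.instance Definition _ := GRing.isZmodClosed.Build _ is_cycle is_cycle_closed.

Record cycle1 := Cycle1 { cycle1_val :> chain 1 X; _ : is_cycle cycle1_val }.
HB.instance Definition _ := [isSub for cycle1_val].
HB.instance Definition _ := [Choice of cycle1 by <:].
HB.instance Definition _ := [SubChoice_isSubZmodule of cycle1 by <:].

Definition is_boundary : {pred cycle1} :=
  fun z => `[< exists c : chain 2 X, boundary c = val z >].

Lemma is_boundary_closed : zmod_closed is_boundary.
Proof.
split=> [|x y]; rewrite /is_boundary !unfold_in.
  by apply/asboolP; exists 0; rewrite raddf0.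
move=> /asboolP[c cx] /asboolP[d dy]; apply/asboolP; exists (c - d).
by rewrite raddfB /= cx dy.
Qed.

HB.instance Definition _ :=
  GRing.isZmodClosed.Build _ is_boundary is_boundary_closed.

(* Singular homology in degree 1, with integral coefficients.                 *)
Definition homology1 := Quotient.quot is_boundary.
HB.instance Definition _ := GRing.Zmodule.on homology1.
HB.instance Definition _ := EqQuotient.on homology1.

Definition homology_class (z : cycle1) : homology1 := \pi z.

Lemma homology_class_zmod : zmod_morphism homology_class.
Proof. exact: (raddfB (\pi_homology1)). Qed.

HB.instance Definition _ :=
  GRing.isZmodMorphism.Build _ _ homology_class homology_class_zmod.

Lemma homology_class_eq0 (z : cycle1) :
  homology_class z = 0 <-> exists c : chain 2 X, boundary c = val z.
Proof.
rewrite -(raddf0 homology_class); split.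
  move=> /eqP; rewrite -[_ == _]Quotient.idealrBE subr0.
  by move=> /asboolP.
move=> h; apply/eqP; rewrite -[_ == _]Quotient.idealrBE subr0.
exact/asboolP.
Qed.

End Chains.

Lemma freeg_scale (K : choiceType) (k : int) (x : K) :
  << k *g x >> = k *: << x >> :> {freeg K / int}.
Proof.
by apply/eqP/freeg_eqP => y; rewrite [RHS]coeff_fgscale !coeffU mul1r.
Qed.

Lemma additive_scale (U V : lmodType int) (F : {additive U -> V}) (k : int) u :
  F (k *: u) = k *: F u.
Proof. by rewrite -[k]intz !scaler_int raddfMz. Qed.

Section ChainMap.
Variables (X Y : topologicalType) (f : continuousType X Y).

Definition chain_map n (c : chain n X) : chain n Y :=
  fglift (fun s : sing n X => << (f \o s : sing n Y) >>) c.

Lemma chain_map_zmod n : zmod_morphism (@chain_map n).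
Proof. exact: lift_is_additive. Qed.

HB.instance Definition _ n :=
  GRing.isZmodMorphism.Build _ _ (@chain_map n) (@chain_map_zmod n).

Lemma chain_map_boundary n (c : chain n.+1 X) :
  boundary (chain_map c) = chain_map (boundary c).
Proof.
elim/freeg_ind_dom0: c => [|k s c _ _ IH]; first by rewrite !raddf0.
rewrite !raddfD /= IH; congr (_ + _).
rewrite freeg_scale !additive_scale; congr (_ *: _).
rewrite /= [X in boundary X]liftU scale1r [LHS]liftU [X in chain_map X]liftU.
rewrite !scale1r raddf_sum.
apply: eq_bigr => i _; rewrite raddfZsign; congr (_ *: _).
rewrite /= [RHS]liftU scale1r; congr (Freeg [:: (_, _)]).
by apply/continuousEP.
Qed.

Lemma cycle_map_subproof (z : cycle1 X) : is_cycle (chain_map z).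
Proof.
have zc : boundary (val z) = 0 by apply/eqP; exact: (valP z).
by apply/eqP; rewrite chain_map_boundary zc raddf0.
Qed.

Definition cycle_map (z : cycle1 X) : cycle1 Y := Cycle1 (cycle_map_subproof z).

Definition homology_map (h : homology1 X) : homology1 Y :=
  homology_class (cycle_map (repr h)).

Lemma homology_mapE (z : cycle1 X) :
  homology_map (homology_class z) = homology_class (cycle_map z).
Proof.
apply/eqP; rewrite -[_ == _]Quotient.idealrBE.
have : repr (homology_class z) - z \in is_boundary (X := X).
  by rewrite Quotient.idealrBE reprK.
move=> /asboolP[c cE]; apply/asboolP; exists (chain_map c).
by rewrite chain_map_boundary cE /= !raddfB.
Qed.

End ChainMap.

(* A closed curve is a continuous map on R of period 1.                       *)
Record closed_curve (X : topologicalType) := ClosedCurve {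
  curve_fun :> R -> X;
  curve_cts : continuous curve_fun;
  curve_periodic : forall t, curve_fun (t + 1) = curve_fun t }.

Section ClosedCurve.
Variables (X : topologicalType) (g : closed_curve X).

Definition curve_simplex_fun (t : set_type (simplex 1)) : X :=
  g (val t ord0 ord_max).

Lemma curve_simplex_cts : continuous curve_simplex_fun.
Proof.
apply: (@cts_comp _ _ _ g (fun t : set_type (simplex 1) => val t ord0 ord_max)).
  exact: curve_cts.
apply: (@cts_comp _ _ _ (fun t : 'rV[R]_2 => t ord0 ord_max)
  (@set_val _ (simplex 1))); last exact: initial_continuous.
exact: coord_continuous.
Qed.

HB.instance Definition _ :=
  isContinuous.Build _ _ curve_simplex_fun curve_simplex_cts.

Definition curve_simplex : sing 1 X := curve_simplex_fun.

Lemma curve_cycle : is_cycle (<< curve_simplex >> : chain 1 X).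
Proof.
apply/eqP; rewrite /boundary liftU scale1r big_ord_recl big_ord1 /=.
rewrite expr0 expr1 scale1r scaleN1r; apply/eqP; rewrite subr_eq0; apply/eqP.
congr (Freeg [:: (_, _)]); apply/continuousEP => t /=.
rewrite /curve_simplex_fun /= !mxE.
have maxE : ord_max = fintype.lift ord0 ord0 :> 'I_2 by exact: val_inj.
rewrite [in LHS]maxE liftK maxE unlift_none.
case: t => t /= /set_mem[_]; rewrite big_ord1 => ->.
by rewrite -[in RHS](curve_periodic g) add0r.
Qed.

Definition curve_class : homology1 X := homology_class (Cycle1 curve_cycle).

End ClosedCurve.
End SingularHomology.

Section RiemannSurfaces.
Variable R : realType.

(* R[i] packed as a numFieldType, so as to be endowed with its topology.      *)
Definition CC : numFieldType := R[i].

Definition real_part (z : CC) : R := complex.Re (z : R[i]).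
Definition imag_part (z : CC) : R := complex.Im (z : R[i]).
Definition unit_circle (t : R) : CC :=
  (cos (2 * pi * t) +i* sin (2 * pi * t))%C : R[i].
Definition complex_of_real (r : R) : CC := (r%:C)%C : R[i].

(* The values of [chart_map] off [chart_dom], and of [chart_inv] off its      *)
(* image, are irrelevant.                                                     *)
Record chart (X : topologicalType) := Chart {
  chart_dom : set X;
  chart_map :> X -> CC;
  chart_inv : CC -> X;
  chart_dom_open : open chart_dom;
  chart_img_open : open (chart_map @` chart_dom);
  chart_mapK : forall x, chart_dom x -> chart_inv (chart_map x) = x;
  chart_map_cts : {within chart_dom, continuous chart_map};
  chart_inv_cts : {within chart_map @` chart_dom, continuous chart_inv} }.

Record closedRiemannSurface := ClosedRiemannSurface {
  surface :> topologicalType;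
  atlas : set (chart surface);
  atlas_cover : forall x : surface, exists c, atlas c /\ chart_dom c x;
  atlas_holomorphic : forall c d, atlas c -> atlas d ->
    forall x, chart_dom c x -> chart_dom d x ->
    derivable (fun z : CC^o => d (chart_inv c z) : CC^o) (c x) 1;
  surface_hausdorff : hausdorff_space surface;
  surface_compact : compact [set: surface];
  surface_connected : connected [set: surface] }.

Section MappingClassGroup.
Variable S : closedRiemannSurface.
Implicit Types f g : continuousType S S.

Definition homeomorphism f : Prop :=
  exists g, cancel f g /\ cancel g f.

(* [h] maps the circle of centre [z] and radius [r] to a curve of winding     *)
(* number 1 around [h z].                                                     *)
Definition winds_once (h : CC -> CC) (z : CC) (r : R) : Prop :=
  exists theta : R -> R, [/\ continuous theta,
    forall t : R, let w := h (z + complex_of_real r * unit_circle t) - h z in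
      w = `|w| * unit_circle (theta t) &
    theta 1 = theta 0 + 1].

Definition orientation_preserving f : Prop :=
  forall (x : S) (c d : chart S), atlas c -> atlas d ->
    chart_dom c x -> chart_dom d (f x) ->
  exists2 e : R, 0 < e &
    forall r : R, 0 < r < e ->
      winds_once (fun z => d (f (chart_inv c z))) (c x) r.

Definition isotopic f g : Prop :=
  exists H : R * S -> S, [/\ continuous H,
    forall t : R, 0 <= t <= 1 ->
      exists2 h, homeomorphism h & forall x, H (t, x) = h x,
    forall x, H (0, x) = f x & forall x, H (1, x) = g x].

(* Subgroups of Mod(S) = Homeo^+(S)/isotopy, as subgroups of Homeo^+(S) that  *)
(* are saturated for isotopy.                                                 *)
Record mcg_subgroup (Gamma : set (continuousType S S)) : Prop := McgSubgroup {
  mcg_homeo : forall f, Gamma f -> homeomorphism f /\ orientation_preserving f;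
  mcg_id : Gamma (idfun : continuousType S S);
  mcg_comp : forall f g, Gamma f -> Gamma g ->
    Gamma (g \o f : continuousType S S);
  mcg_inv : forall f g, Gamma f -> cancel f g -> cancel g f -> Gamma g;
  mcg_isotopic : forall f g, Gamma f -> homeomorphism g ->
    orientation_preserving g -> isotopic f g -> Gamma g }.

(* For a closed orientable surface, H_1(S, Z) is free of rank 2g.             *)
Definition has_genus (g : nat) : Prop :=
  exists u : {additive 'rV[int]_g.*2 -> homology1 R S}, bijective u.

End MappingClassGroup.

Section IntersectionForm.
Variable S : closedRiemannSurface.
Implicit Types (a b : closed_curve R S).
Implicit Types (omega : homology1 R S -> homology1 R S -> int).

(* [a] and [b] cross transversally at [a s = b t], with sign [e].             *)
Definition crossing a b (s t : R) (e : int) : Prop :=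
  exists (c : chart S) (a1 a2 b1 b2 : R),
  [/\ atlas c /\ chart_dom c (a s),
      is_derive s (1 : R) (fun u : R => real_part (c (a u))) a1 /\
      is_derive s (1 : R) (fun u : R => imag_part (c (a u))) a2,
      is_derive t (1 : R) (fun u : R => real_part (c (b u))) b1 /\
      is_derive t (1 : R) (fun u : R => imag_part (c (b u))) b2,
      a1 * b2 - a2 * b1 != 0 &
      e = sgz (a1 * b2 - a2 * b1)].

(* The intersection form counts, with signs, the intersection points of       *)
(* curves in general position. This determines it, as any two classes of      *)
(* H_1(S, Z) are represented by such curves.                                  *)
Record intersection_form omega : Prop := IntersectionForm {
  form_addl : forall x y z, omega (x + y) z = omega x z + omega y z;
  form_addr : forall x y z, omega x (y + z) = omega x y + omega x z;
  form_alt : forall x, omega x x = 0;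
  form_count : forall a b (L : seq (R * R)) (sign : R * R -> int),
    uniq L ->
    (forall s t, 0 <= s < 1 -> 0 <= t < 1 -> (a s = b t <-> (s, t) \in L)) ->
    (forall s t, (s, t) \in L ->
      [/\ 0 <= s < 1, 0 <= t < 1 & crossing a b s t (sign (s, t))]) ->
    omega (curve_class a) (curve_class b) = \sum_(p <- L) sign p }.

Definition homology_subgroup (V : set (homology1 R S)) : Prop :=
  V 0 /\ forall x y, V x -> V y -> V (x - y).

(* Unimodularity: [omega] induces an isomorphism from V to Hom(V, Z).         *)
Definition symplectic_subspace omega (V : set (homology1 R S)) : Prop :=
  [/\ homology_subgroup V,
      forall v, V v -> (forall w, V w -> omega v w = 0) -> v = 0 &
      forall phi : homology1 R S -> int,
        (forall x y, V x -> V y -> phi (x + y) = phi x + phi y) ->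
        exists2 v, V v & forall w, V w -> phi w = omega v w].

Definition orthogonal omega (V : set (homology1 R S)) : set (homology1 R S) :=
  [set x | forall v, V v -> omega x v = 0].

Definition Sp omega : set (homology1 R S -> homology1 R S) :=
  [set h | [/\ zmod_morphism h, bijective h &
    forall x y, omega (h x) (h y) = omega x y]].

Definition SpV omega (V : set (homology1 R S)) :
    set (homology1 R S -> homology1 R S) :=
  [set h | [/\ Sp omega h, h @` V = V &
    forall x, orthogonal omega V x -> h x = x]].

End IntersectionForm.
End RiemannSurfaces.

Section GeneratedSubalgebra.
Variables (K : fieldType) (T : Type).

Inductive gen_subalg (gens : set (T -> K)) : (T -> K) -> Prop :=
| Gen_cst c : gen_subalg gens (fun=> c)
| Gen_gen f : gens f -> gen_subalg gens f
| Gen_add f g : gen_subalg gens f -> gen_subalg gens g ->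
    gen_subalg gens (fun x => f x + g x)
| Gen_mul f g : gen_subalg gens f -> gen_subalg gens g ->
    gen_subalg gens (fun x => f x * g x).

End GeneratedSubalgebra.

(* Linear algebraic groups, as Zariski closed subgroups of GL_n(K), for K     *)
(* algebraically closed.                                                      *)
Section AlgebraicGroups.
Variable K : fieldType.

Definition polynomial_fun n : set ('M[K]_n -> K) :=
  gen_subalg [set f | exists i j, f = fun g : 'M[K]_n => g i j].

Definition regular_fun n : set ('M[K]_n -> K) :=
  gen_subalg [set f | (exists i j, f = fun g : 'M[K]_n => g i j) \/
                      f = fun g => (\det g)^-1].

Definition zariski_closed n (Z : set 'M[K]_n) : Prop :=
  exists2 E : set ('M[K]_n -> K), E `<=` @polynomial_fun n &
    Z = [set g | g \in unitmx /\ forall p, E p -> p g = 0].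

Definition zariski_irreducible n (Z : set 'M[K]_n) : Prop :=
  Z !=set0 /\ forall Z1 Z2, zariski_closed Z1 -> zariski_closed Z2 ->
    Z `<=` Z1 `|` Z2 -> Z `<=` Z1 \/ Z `<=` Z2.

Definition zariski_connected n (Z : set 'M[K]_n) : Prop :=
  forall Z1 Z2, zariski_closed Z1 -> zariski_closed Z2 ->
    Z `<=` Z1 `|` Z2 -> Z `&` Z1 `&` Z2 = set0 -> Z `<=` Z1 \/ Z `<=` Z2.

(* The Krull dimension of [Z] is at least [d].                                *)
Definition dim_ge n (Z : set 'M[K]_n) (d : nat) : Prop :=
  exists c : nat -> set 'M[K]_n,
    (forall k, (k <= d)%N ->
       [/\ zariski_closed (c k), zariski_irreducible (c k) & c k `<=` Z]) /\
    (forall k, (k < d)%N -> c k `<` c k.+1).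

Record alg_group n := AlgGroup {
  ag_set :> 'M[K]_n -> Prop;
  ag_closed : zariski_closed ag_set;
  ag_1 : ag_set 1%:M;
  ag_mul : forall g h, ag_set g -> ag_set h -> ag_set (g *m h);
  ag_inv : forall g, ag_set g -> ag_set (invmx g) }.

Definition alg_morphism m n (G : alg_group m) (H : alg_group n)
    (phi : 'M[K]_m -> 'M[K]_n) : Prop :=
  [/\ forall g, G g -> H (phi g),
      forall g h, G g -> G h -> phi (g *m h) = phi g *m phi h &
      forall i j, exists2 f, regular_fun f & forall g, G g -> phi g i j = f g].

Definition commutative_group n (G : alg_group n) : Prop :=
  forall g h, G g -> G h -> g *m h = h *m g.

Definition abelianisation m n (G : alg_group m) (A : alg_group n)
    (ab : 'M[K]_m -> 'M[K]_n) : Prop :=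
  [/\ commutative_group A, alg_morphism G A ab &
    forall k (B : alg_group k) (psi : 'M[K]_m -> 'M[K]_k),
      commutative_group B -> alg_morphism G B psi ->
      exists2 chi,
        alg_morphism A B chi /\ (forall g, G g -> psi g = chi (ab g)) &
        forall chi', alg_morphism A B chi' ->
          (forall g, G g -> psi g = chi' (ab g)) ->
          forall a, A a -> chi' a = chi a].

Definition unipotent n (U : alg_group n) : Prop :=
  forall u, U u -> exists k, (u - 1%:M) ^+ k = 0.

Definition normal_subgroup n (U G : alg_group n) : Prop :=
  (forall u, U u -> G u) /\ forall g u, G g -> U u -> U (g *m u *m invmx g).

(* The unipotent radical is trivial; [G] need not be connected.               *)
Definition reductive n (G : alg_group n) : Prop :=
  forall U : alg_group n, normal_subgroup U G -> zariski_connected (ag_set U) ->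
    unipotent U -> forall u, U u -> u = 1%:M.

End AlgebraicGroups.

Section CharacterVariety.
Variables (K : fieldType) (n : nat) (G : alg_group K n) (Pi : groupType).

Record rep := Rep {
  rep_fun :> Pi -> 'M[K]_n;
  rep_in : forall a, G (rep_fun a);
  rep_mul : forall a b, rep_fun (a * b)%g = rep_fun a *m rep_fun b }.

Lemma ag_unit (g : 'M[K]_n) : G g -> g \in unitmx.
Proof. by case: (ag_closed G) => E _ -> []. Qed.

Lemma rep_conj_in g (Gg : G g) (rho : rep) a : G (g *m rho a *m invmx g).
Proof.
by apply: ag_mul; [apply: ag_mul => //; exact: rep_in|exact: ag_inv].
Qed.

Lemma rep_conj_mul g (Gg : G g) (rho : rep) a b :
  g *m rho (a * b)%g *m invmx g =
  (g *m rho a *m invmx g) *m (g *m rho b *m invmx g).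
Proof. by rewrite rep_mul !mulmxA mulmxKV// ag_unit. Qed.

Definition rep_conj g (Gg : G g) (rho : rep) : rep :=
  Rep (@rep_conj_in g Gg rho) (@rep_conj_mul g Gg rho).

Section Pullback.
Variable phi : Pi -> Pi.
Variable phiM : forall a b, phi (a * b)%g = (phi a * phi b)%g.

Lemma rep_pull_mul (rho : rep) a b :
  rho (phi (a * b)%g) = rho (phi a) *m rho (phi b).
Proof. by rewrite phiM rep_mul. Qed.

Definition rep_pull (rho : rep) : rep :=
  Rep (fun a => rep_in rho (phi a)) (@rep_pull_mul rho).

End Pullback.

(* The coordinate ring of the representation variety; it is generated by the  *)
(* matrix entries, as (\det (rho a))^-1 = \det (rho a^-1).                    *)
Definition rep_coord : set (rep -> K) :=
  gen_subalg [set F | exists a i j, F = fun rho : rep => rho a i j].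

(* The coordinate ring of the GIT quotient.                                   *)
Definition char_coord : set (rep -> K) :=
  [set F | rep_coord F /\ forall g (Gg : G g) rho, F (rep_conj Gg rho) = F rho].

(* Closed points of the GIT quotient, i.e., K-algebra morphisms from its      *)
(* coordinate ring to K (the values off [char_coord] are irrelevant).         *)
Record char_point := CharPoint {
  point_eval :> (rep -> K) -> K;
  point_cst : forall c, point_eval (fun=> c) = c;
  point_add : forall F F', char_coord F -> char_coord F' ->
    point_eval (fun rho => F rho + F' rho) = point_eval F + point_eval F';
  point_mul : forall F F', char_coord F -> char_coord F' ->
    point_eval (fun rho => F rho * F' rho) = point_eval F * point_eval F' }.

Definition zariski_dense (D : set char_point) : Prop :=
  forall F, char_coord F -> (forall x, D x -> x F = 0) ->
    forall x : char_point, x F = 0.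

(* Rational functions are the elements of the total ring of fractions of the  *)
(* coordinate ring, as the GIT quotient need not be irreducible.              *)
Record ratfun := RatFun {
  num : rep -> K;
  den : rep -> K;
  num_coord : char_coord num;
  den_coord : char_coord den;
  den_regular : forall F, char_coord F ->
    (forall rho, F rho * den rho = 0) -> forall rho, F rho = 0 }.

Definition eq_fractions (f s f' s' : rep -> K) : Prop :=
  forall rho, f rho * s' rho = f' rho * s rho.

Definition ratfun_constant (q : ratfun) : Prop :=
  exists c, eq_fractions (num q) (den q) (fun=> c) (fun=> 1).

End CharacterVariety.

Section MappingClassGroupAction.
Variables (R : realType) (S : closedRiemannSurface R) (x0 : S).
Variables (n : nat) (G : alg_group (CC R) n).

(* The action of the class of [f] on functions on representations of          *)
(* pi_1(S, x0), where [w] is an auxiliary path from [x0] to [f x0]; on        *)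
(* conjugation-invariant functions it does not depend on [w].                 *)
Definition mcg_pull (f : continuousType S S) (w : path R x0 (f x0))
    (F : rep G (pi1 R x0) -> CC R) : rep G (pi1 R x0) -> CC R :=
  fun rho => F (rep_pull (pi1_mapM w) rho).

Definition ratfun_invariant (Gamma : set (continuousType S S))
    (q : ratfun G (pi1 R x0)) : Prop :=
  forall (f : continuousType S S) (w : path R x0 (f x0)), Gamma f ->
    eq_fractions (mcg_pull w (num q)) (mcg_pull w (den q)) (num q) (den q).

Definition mcg_orbit (Gamma : set (continuousType S S))
    (x : char_point G (pi1 R x0)) : set (char_point G (pi1 R x0)) :=
  [set y | exists (f : continuousType S S) (w : path R x0 (f x0)),
    Gamma f /\ forall F, char_coord F -> y F = x (mcg_pull w F)].

End MappingClassGroupAction.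

(* Main.v *)
(* V is proper and unimodular, so its orthogonal complement contains some     *)
(* y <> 0; as H_1 is free, y can be divided until phi(y) = 1 for some         *)
(* phi : H_1 -> Z. Lift y to a loop a. The matrix entries of ab(rho(a)) are   *)
(* conjugation invariant, and depend on rho and on the homology class y of a  *)
(* only, hence are invariant under Gamma, which fixes y. They are not all     *)
(* constant: if ab(h) <> 1, compare the trivial representation with           *)
(* b |-> h^phi([b]). An invariant function is constant on orbits, so that a   *)
(* dense orbit would make it constant. The topological input is the Hurewicz  *)
(* theorem: H_1 is the abelianisation of pi_1.                                *)

Require Import Defs.
From HB Require Import structures.
From mathcomp Require Import freeg complex.
From mathcomp Require Import all_boot all_order all_algebra.
From mathcomp Require Import all_classical all_reals all_analysis.
From mathcomp Require Import lra.
(* [path] is shadowed by [mathcomp.boot.path]. *)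
Import Defs.

Set Implicit Arguments.
Unset Strict Implicit.
Unset Printing Implicit Defensive.

Import Order.TTheory GRing.Theory Num.Theory.
Import numFieldNormedType.Exports.

Local Open Scope classical_set_scope.
Local Open Scope ring_scope.

(** * Affine simplices and homologous chains *)

(** A homomorphism from pi_1 to a commutative group sees only the homology class of a loop. For [ab]
    composed with a representation [rho], this makes the entries of [ab (rho a)] invariant under
    every mapping class that fixes the class of [a]; and [Gamma] fixes all classes orthogonal to
    [V]. [orthogonal_neq0], [primitive_functional] and [orthogonal_divisible] supply such a class on
    which some functional H_1 -> Z takes the value 1. Through this functional, [power_rep] gives
    representations sending [a] to any prescribed element of [G], so that by
    [abelianisation_nontrivial] some entry is not constant.

    The topology enters through three lemmas: [hurewicz_surj] lifts the class to a loop,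
    [hurewicz_char] is the factorisation through H_1, and [hurewicz_natural] turns the action on
    pi_1 into the action on H_1. They rest on [segment_triangle], which produces boundaries, and on
    [chain_char_boundary], which shows that a character of pi_1, extended to chains, kills
    boundaries. *)

HB.instance Definition _ (R : realType) (X : topologicalType) (x y : X)
    (p : path R x y) :=
  isContinuous.Build R X (path_fun p) (@path_cts R X x y p).

Section AffineSimplices.
Variables (R : realType) (n : nat).

Definition bary_coord (i : 'I_n.+1) (t : set_type (@simplex R n)) : R :=
  val t ord0 i.

Lemma bary_coord_cts i : continuous (bary_coord i).
Proof.
apply: (@cts_comp _ _ _ (fun t : 'rV[R]_n.+1 => t ord0 i)
  (@set_val _ (@simplex R n))); last exact: initial_continuous.
exact: coord_continuous.
Qed.

HB.instance Definition _ i :=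
  isContinuous.Build _ _ (bary_coord i) (@bary_coord_cts i).

Lemma bary_sum_cts (c : 'I_n.+1 -> R) :
  continuous (fun t : set_type (@simplex R n) => \sum_i bary_coord i t * c i).
Proof.
elim: (index_enum _) => [|i r IH].
  by under eq_fun do rewrite big_nil; exact: cts_cst.
under eq_fun do rewrite big_cons.
apply: cts_add => //; apply: cts_mul; last exact: cts_cst.
exact: bary_coord_cts.
Qed.

Definition affine_map (P : 'I_n.+1 -> R * R) (t : set_type (@simplex R n)) :
    R * R :=
  (\sum_i bary_coord i t * (P i).1, \sum_i bary_coord i t * (P i).2).

Lemma affine_map_cts P : continuous (affine_map P).
Proof. by apply: cts_pair; exact: bary_sum_cts. Qed.

HB.instance Definition _ P :=
  isContinuous.Build _ _ (affine_map P) (@affine_map_cts P).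

End AffineSimplices.

Section BoundaryEquivalence.
Variables (R : realType) (X : topologicalType).
Implicit Types c d : chain R 1 X.

(** Stated for arbitrary chains and not only for cycles, so that loops can be cut into paths that
    are not closed. *)
Definition homologous c d : Prop := exists e : chain R 2 X, boundary e = c - d.

Lemma homologous_refl c : homologous c c.
Proof. by exists 0; rewrite raddf0 subrr. Qed.

Lemma homologous_sym c d : homologous c d -> homologous d c.
Proof. by move=> [e ee]; exists (- e); rewrite raddfN /= ee opprB. Qed.

Lemma homologous_trans c d e :
  homologous c d -> homologous d e -> homologous c e.
Proof.
by move=> [a ae] [b be]; exists (a + b); rewrite raddfD /= ae be addrA subrK.
Qed.

Lemma homologousD c c' d d' :
  homologous c c' -> homologous d d' -> homologous (c + d) (c' + d').
Proof.
move=> [a ae] [b be]; exists (a + b).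
by rewrite raddfD /= ae be addrACA opprD.
Qed.

Lemma homologousN c d : homologous c d -> homologous (- c) (- d).
Proof. by move=> [e ee]; exists (- e); rewrite raddfN /= ee opprD. Qed.

Lemma homologous_classP (z z' : cycle1 R X) :
  homology_class z = homology_class z' <-> homologous (val z) (val z').
Proof.
rewrite /homologous -[val z - val z']/(val (z - z')) -homology_class_eq0.
have -> : homology_class (z - z') = homology_class z - homology_class z'.
  by rewrite raddfB.
by split=> [->|/eqP]; [rewrite subrr|rewrite subr_eq0; move/eqP].
Qed.

End BoundaryEquivalence.

Section AffineChains.
Variables (R : realType) (X : topologicalType).
Variable K : continuousType (R * R)%type X.
Implicit Types P Q : R * R.

Definition affine_simplex n (P : 'I_n.+1 -> R * R) : sing R n X :=
  (K \o affine_map P : continuousType _ _).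

Definition segment P Q :=
  affine_simplex (fun i : 'I_2 => if val i is 0 then P else Q).

Lemma affine_map_face n (P : 'I_n.+2 -> R * R) (i : 'I_n.+2)
    (t : set_type (@simplex R n)) :
  affine_map P (face i t) = affine_map (fun j => P (fintype.lift i j)) t.
Proof.
rewrite /affine_map /bary_coord /= !(bigD1_ord i)//= !mxE unlift_none.
rewrite !mul0r !add0r.
by congr (_, _); apply: eq_bigr => j _; rewrite mxE liftK.
Qed.

(** The three segments are the faces of one affine triangle, mapped by [K]. All relations between
    path simplices below come from this one, with [K] a homotopy or a path in the first
    coordinate. *)
Lemma segment_triangle P0 P1 P2 :
  homologous (<< segment P0 P1 >> + << segment P1 P2 >>) << segment P0 P2 >>.
Proof.
pose P (i : 'I_3) := if val i is 0 then P0 else if val i is 1 then P1 else P2.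
exists << affine_simplex P >>.
rewrite /boundary liftU scale1r !big_ord_recl big_ord0 /=.
rewrite expr0 expr1 expr2 mulN1r opprK !scale1r scaleN1r addr0.
have E (i : 'I_3) : (affine_simplex P \o face i : sing R 1 X) =
    affine_simplex (fun j => P (fintype.lift i j)).
  by apply/continuousEP => t /=; rewrite affine_map_face.
rewrite !E [LHS]addrC -[LHS]addrA [LHS]addrC;
  congr (<< _ >> + << _ >> - << _ >>);
  by congr (affine_simplex _); apply/funext => -[[|[|//]] ?].
Qed.

End AffineChains.

Definition mk_continuous (X Y : topologicalType) (f : X -> Y)
  (cf : continuous f) : continuousType X Y :=
  HB.pack f (isContinuous.Build X Y f cf).

Section PathChains.
Variables (R : realType) (X : topologicalType).
Implicit Types x y z : X.

Definition path_simplex x y (p : path R x y) : sing R 1 X :=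
  (p \o bary_coord ord_max : continuousType _ _).

Lemma segment_path x y (p : path R x y) (K : continuousType (R * R)%type X)
    (P Q : R * R) :
  (forall t : R, 0 <= t <= 1 ->
    K ((1 - t) * P.1 + t * Q.1, (1 - t) * P.2 + t * Q.2) = p t) ->
  segment K P Q = path_simplex p.
Proof.
move=> Kp; apply/continuousEP => -[t /= tS].
have /set_mem[t0] := tS; rewrite big_ord_recl big_ord1 => t1.
rewrite /affine_map /bary_coord /= !big_ord_recl !big_ord0 /= !addr0.
have maxE : ord_max = fintype.lift ord0 ord0 :> 'I_2 by exact: val_inj.
rewrite maxE -Kp; last first.
  by have := t0 ord0; have := t0 (fintype.lift ord0 ord0); lra.
by rewrite -t1 addrK.
Qed.

(* Uses the degenerate affine 2-simplex with vertices 0, 1/2, 1. *)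
Lemma homologous_cat x y z (p : path R x y) (q : path R y z) :
  homologous (<< path_simplex p >> + << path_simplex q >>)
             << path_simplex (cat_path p q) >>.
Proof.
pose K := mk_continuous
  (cts_comp (@path_cts _ _ _ _ (cat_path p q)) (@cts_fst R R)).
have := @segment_triangle R X K (0, 0) (2^-1, 0) (1, 0).
rewrite (@segment_path _ _ p) => [|t t01 /=]; last first.
  by rewrite ifT; [congr (p _); lra|lra].
rewrite (@segment_path _ _ q) => [|t t01 /=]; last first.
  (* The first branch occurs only at [t = 0], where both paths are at [y]. *)
  case: ifPn => t2; last by congr (q _); lra.
  by rewrite (path_le0 q) ?(path_ge1 p) //; lra.
by rewrite (@segment_path _ _ (cat_path p q)) => [|t t01 /=];
  rewrite ?mulr0 ?mulr1 ?add0r.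
Qed.

(** A constant triangle shows that twice this simplex is homologous to the simplex itself; one copy
    is then cancelled. *)
Lemma homologous_cst x : homologous << path_simplex (cst_path R x) >> 0.
Proof.
pose K := mk_continuous
  (cts_comp (@path_cts _ _ _ _ (cst_path R x)) (@cts_fst R R)).
have := @segment_triangle R X K (0, 0) (0, 0) (0, 0).
rewrite (@segment_path _ _ (cst_path R x)) // => h.
move/homologousD: h => /(_ _ _ (homologous_refl
  (- << path_simplex (cst_path R x) >>))).
by rewrite addrK subrr.
Qed.

(** The diagonal cuts the square of the homotopy into two triangles. Two opposite sides of the
    square are [p] and [q], and the other two are constant paths. *)
Lemma homologous_homotopic x y (p q : path R x y) :
  homotopic p q -> homologous << path_simplex p >> << path_simplex q >>.
Proof.
move=> [H [cH H0 H1 Hb]]; pose K := mk_continuous cH.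
have h1 := @segment_triangle R X K (0, 0) (0, 1) (1, 1).
have h2 := @segment_triangle R X K (0, 0) (1, 0) (1, 1).
move: h1; rewrite (@segment_path _ _ p) => [|t t01 /=]; last first.
  by rewrite -H0; congr (H (_, _)); lra.
rewrite (@segment_path _ _ (cst_path R y)) => [h1|t t01 /=]; last first.
  by apply: (Hb _ _).2; lra.
move: h2; rewrite (@segment_path _ _ (cst_path R x)) => [|t t01 /=]; last first.
  by apply: (Hb _ _).1; lra.
rewrite (@segment_path _ _ q) => [h2|t t01 /=]; last first.
  by rewrite -H1; congr (H (_, _)); lra.
have cx := homologous_cst x; have cy := homologous_cst y.
apply: (@homologous_trans _ _ _ (<< path_simplex p >> +
                                 << path_simplex (cst_path R y) >>)).
  rewrite -[X in homologous X]addr0; apply: homologousD.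
    exact: homologous_refl.
  exact: homologous_sym.
apply: homologous_trans h1 _; apply: homologous_trans (homologous_sym h2) _.
rewrite -[X in homologous _ X]add0r; apply: homologousD => //.
exact: homologous_refl.
Qed.

Lemma homologous_rev x y (p : path R x y) :
  homologous << path_simplex (rev_path p) >> (- << path_simplex p >>).
Proof.
rewrite -[X in homologous X](addKr << path_simplex p >>).
rewrite -[X in homologous _ X]addr0.
apply: homologousD; first exact: homologous_refl.
apply: homologous_trans (homologous_cat _ _) _.
apply: homologous_trans (homologous_homotopic (cat_path_rev p)) _.
exact: homologous_cst.
Qed.

Definition point_simplex x : sing R 0 X := mk_continuous (@cst_continuous _ _ x).

Lemma boundary_path x y (p : path R x y) :
  boundary << path_simplex p >> = << point_simplex y >> - << point_simplex x >>.
Proof.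
rewrite /boundary liftU scale1r big_ord_recl big_ord1 /=.
rewrite expr0 expr1 scale1r scaleN1r.
congr (<< _ >> - << _ >>); apply/continuousEP => t;
  rewrite /= /bary_coord /= mxE;
  have -> : ord_max = fintype.lift ord0 ord0 :> 'I_2 by exact: val_inj.
  rewrite liftK path_ge1 //.
  by case: t => t /= /set_mem[_]; rewrite big_ord1 => ->.
by rewrite unlift_none path_le0.
Qed.

Lemma loop_cycle x (p : path R x x) :
  is_cycle (<< path_simplex p >> : chain R 1 X).
Proof. by apply/eqP; rewrite boundary_path subrr. Qed.

Definition hurewicz x (a : pi1 R x) : homology1 R X :=
  homology_class (Cycle1 (loop_cycle (repr a))).

Lemma hurewiczE x (p : path R x x) :
  hurewicz (pi1_class p) = homology_class (Cycle1 (loop_cycle p)).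
Proof. exact/homologous_classP/homologous_homotopic/repr_homotopic. Qed.

Lemma hurewiczM x (a b : pi1 R x) :
  hurewicz (a * b)%g = hurewicz a + hurewicz b.
Proof.
elim/pi1_ind: a => p; elim/pi1_ind: b => q.
rewrite [(_ * _)%g]pi1_mulE !hurewiczE -raddfD.
exact/homologous_classP/homologous_sym/homologous_cat.
Qed.

End PathChains.

(** * The Hurewicz theorem *)

(** In homology the connecting path [w] and its reverse cancel. *)
Lemma hurewicz_natural (R : realType) (X Y : topologicalType)
    (f : continuousType X Y) (x0 : X) (y0 : Y) (w : path R y0 (f x0))
    (a : pi1 R x0) :
  hurewicz (pi1_map w a) = homology_map f (hurewicz a).
Proof.
elim/pi1_ind: a => p; rewrite pi1_mapE !hurewiczE homology_mapE.
apply/homologous_classP; rewrite /= /chain_map liftU scale1r.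
have -> : (f \o path_simplex p : sing R 1 Y) = path_simplex (map_path f p).
  exact/continuousEP.
apply: homologous_trans (homologous_sym (homologous_cat _ _)) _.
rewrite -[X in homologous _ X](addrK << path_simplex w >>).
rewrite [X in homologous _ (X - _)]addrC.
apply: homologousD (homologous_sym (homologous_cat _ _)) (homologous_rev _).
Qed.

Section SimplexPaths.
Variables (R : realType) (n : nat).
Notation T := (set_type (@simplex R n)).

(** Retracts the line onto the unit interval, since a [path] is defined on all of [R] and stays at
    its end points outside that interval. *)
Definition clamp (t : R) : R := Num.max 0 (Num.min 1 t).

Lemma clamp_cts : continuous clamp.
Proof.
move=> s; apply: continuous_max; first exact: cst_continuous.
by apply: continuous_min; [exact: cst_continuous|exact: cvg_id].
Qed.

Lemma clamp01 t : 0 <= clamp t <= 1.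
Proof. by rewrite /clamp le_max lexx /= ge_max ler01 ge_min lexx. Qed.

Lemma clamp_id t : 0 <= t <= 1 -> clamp t = t.
Proof. by case/andP=> t0 t1; rewrite /clamp (min_idPr t1) (max_idPr t0). Qed.

Lemma clamp_le0 t : t <= 0 -> clamp t = 0.
Proof.
by move=> t0; rewrite /clamp; apply/max_idPl; rewrite ge_min t0 orbT.
Qed.

Lemma clamp_ge1 t : 1 <= t -> clamp t = 1.
Proof. by move=> t1; rewrite /clamp (min_idPl t1) (max_idPr _) ?ler01. Qed.

Definition convex_comb_fun (u : R * (T * T)) : 'rV[R]_n.+1 :=
  (1 - clamp u.1) *: val u.2.1 + clamp u.1 *: val u.2.2.

Lemma convex_comb_in u : convex_comb_fun u \in @simplex R n.
Proof.
case: u => s [[a aS] [b bS]]; rewrite /convex_comb_fun /=.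
have [a0 a1] := set_mem aS; have [b0 b1] := set_mem bS.
have /andP[s0 s1] := clamp01 s; apply/mem_set; split=> [i|].
  by rewrite !mxE addr_ge0 ?mulr_ge0// subr_ge0.
under eq_bigr do rewrite !mxE.
by rewrite big_split /= -!mulr_sumr a1 b1 !mulr1 subrK.
Qed.

Definition convex_comb u : T :=
  exist (fun v => v \in @simplex R n) _ (convex_comb_in u).

Lemma convex_comb_cts : continuous convex_comb.
Proof.
apply: continuous_comp_initial.
have valc : continuous (@set_val _ (@simplex R n)) by exact: initial_continuous.
have clc : continuous (fun u : R * (T * T) => clamp u.1).
  by apply: cts_comp; [exact: clamp_cts|exact: cts_fst].
move=> u; apply: cvgD; apply: cvgZ.
- by apply: cvgB; [exact: cvg_cst|exact: clc].
- apply: (@cts_comp _ _ _ (@set_val _ (@simplex R n))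
    (fun u : R * (T * T) => u.2.1)) => //.
  by apply: cts_comp; [exact: cts_fst|exact: cts_snd].
- exact: clc.
- apply: (@cts_comp _ _ _ (@set_val _ (@simplex R n))
    (fun u : R * (T * T) => u.2.2)) => //.
  by apply: cts_comp; [exact: cts_snd|exact: cts_snd].
Qed.

Lemma convex_comb0 t a b : t <= 0 -> convex_comb (t, (a, b)) = a.
Proof.
move=> t0; apply: val_inj.
by rewrite /= /convex_comb_fun /= clamp_le0// subr0 scale1r scale0r addr0.
Qed.

Lemma convex_comb1 t a b : 1 <= t -> convex_comb (t, (a, b)) = b.
Proof.
move=> t1; apply: val_inj.
by rewrite /= /convex_comb_fun /= clamp_ge1// subrr scale1r scale0r add0r.
Qed.

Lemma convex_combxx t a : convex_comb (t, (a, a)) = a.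
Proof.
by apply: val_inj; rewrite /= /convex_comb_fun /= -scalerDl subrK scale1r.
Qed.

Lemma line_cts (a b : T) : continuous (fun t : R => convex_comb (t, (a, b))).
Proof.
apply: cts_comp; first exact: convex_comb_cts.
by apply: cts_pair; [exact: cts_id|move=> ?; exact: cvg_cst].
Qed.

Definition line (a b : T) : path R a b :=
  Path (@line_cts a b) (fun t => @convex_comb0 t a b)
    (fun t => @convex_comb1 t a b).

(** The straight-line homotopy stays in the simplex by convexity. *)
Lemma simplex_homotopic (a b : T) (p q : path R a b) : homotopic p q.
Proof.
exists (fun u => convex_comb (u.1, (p u.2, q u.2))); split=> [|t|t|s _] /=.
- apply: cts_comp; first exact: convex_comb_cts.
  apply: cts_pair; first exact: cts_fst.
  by apply: cts_pair; (apply: cts_comp; [exact: path_cts|exact: cts_snd]).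
- exact: convex_comb0.
- exact: convex_comb1.
- by split=> t ht; rewrite ?(path_le0 _ ht) ?(path_ge1 _ ht) convex_combxx.
Qed.

Lemma vertex_in (i : 'I_n.+1) : delta_mx ord0 i \in @simplex R n.
Proof.
apply/mem_set; split=> [j|]; first by rewrite mxE ler0n.
rewrite (bigD1 i)//= mxE !eqxx big1 ?addr0// => j ji.
by rewrite mxE (negPf ji).
Qed.

Definition vertex (i : 'I_n.+1) : T :=
  exist (fun v => v \in @simplex R n) _ (vertex_in i).

End SimplexPaths.

Lemma face_vertex (R : realType) n (i : 'I_n.+2) (j : 'I_n.+1) :
  face i (vertex R j) = vertex R (fintype.lift i j).
Proof.
apply: val_inj; apply/rowP => k; rewrite !mxE.
case: unliftP => [l ->|->]; rewrite ?mxE /=.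
  by rewrite (inj_eq lift_inj).
by rewrite (negPf (neq_lift _ _)).
Qed.

(** The basis elements generate the free abelian group, so integer coefficients need not appear in
    the induction. *)
Lemma freeg_subgroup_ind (K : choiceType) (Q : {freeg K / int} -> Prop) :
  Q 0 -> (forall x, Q << x >>) -> (forall c d, Q c -> Q d -> Q (c - d)) ->
  forall c, Q c.
Proof.
move=> Q0 Q1 QB.
have QN c : Q c -> Q (- c) by move=> Qc; rewrite -sub0r; exact: QB.
have QD c d : Q c -> Q d -> Q (c + d).
  by move=> Qc Qd; rewrite -[d]opprK; apply: QB => //; exact: QN.
have QM c n : Q c -> Q (c *+ n).
  by move=> Qc; elim: n => [|n IH]; rewrite ?mulr0n// mulrS; exact: QD.
elim/freeg_ind_dom0 => // k s c _ _ Qc; apply: QD => //.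
rewrite freeg_scale -[k]intz scaler_int; case: k => n; first exact: QM.
by rewrite NegzE mulrNz; apply: QN; exact: QM.
Qed.

Section HurewiczTheorem.
Variables (R : realType) (X : topologicalType) (x0 : X).
Variable base : forall x : X, path R x0 x.
Implicit Types x y z : X.

Definition simplex_path (s : sing R 1 X) :
    path R (s (vertex R ord0)) (s (vertex R ord_max)) :=
  map_path s (line _ _).

Lemma simplex_pathK s : path_simplex (simplex_path s) = s.
Proof.
apply/continuousEP => t /=; congr (s _); apply: val_inj; apply/rowP => i.
case: t => t /= tS; have [t0] := set_mem tS; rewrite big_ord_recl big_ord1.
rewrite /convex_comb_fun /bary_coord /= !mxE eqxx /=.
have -> : ord_max = fintype.lift ord0 ord0 :> 'I_2 by exact: val_inj.
move=> t1; have := t0 ord0; have := t0 (fintype.lift ord0 ord0) => ? ?.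
rewrite clamp_id; last by lra.
case: (unliftP ord0 i) => [j ->|->] /=; rewrite ?(ord1 j) /= ?mulr0 ?mulr1; lra.
Qed.

Definition based_loop x y (p : path R x y) : path R x0 x0 :=
  cat_path (cat_path (base x) p) (rev_path (base y)).

(* A cycle is unchanged if each of its simplices is extended, by the paths    *)
(* [base], to a loop at [x0].                                                 *)
Lemma hurewicz_surj (h : homology1 R X) : exists a : pi1 R x0, hurewicz a = h.
Proof.
(* For a simplex [c] from [x] to [y], the chain [c - cone (boundary c)] is [c] plus [base x] minus
   [base y], hence homologous to the based loop along [c]. For a cycle the correction vanishes. *)
pose cone : chain R 0 X -> chain R 1 X :=
  fglift (fun s : sing R 0 X => << path_simplex (base (s (vertex R ord0))) >>).
have coneB : zmod_morphism cone by exact: lift_is_additive.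
have cone0 : cone 0 = 0 by rewrite -(subrr 0) coneB subrr.
have main (c : chain R 1 X) : exists p : path R x0 x0,
    homologous (c - cone (boundary c)) << path_simplex p >>.
  elim/freeg_subgroup_ind: c => [|s|c d [p cp] [q dq]].
  - exists (cst_path R x0); rewrite raddf0 cone0 subr0.
    exact/homologous_sym/homologous_cst.
  - exists (based_loop (simplex_path s)); apply: homologous_sym.
    apply: homologous_trans (homologous_sym (homologous_cat _ _)) _.
    have -> : boundary << s >> = << point_simplex R (s (vertex R ord_max)) >> -
        << point_simplex R (s (vertex R ord0)) >> :> chain R 0 X.
      by rewrite -(boundary_path (simplex_path s)) simplex_pathK.
    rewrite coneB /cone !liftU !scale1r /= opprB addrA.
    apply: homologousD (homologous_rev _).
    rewrite addrC; apply: homologous_sym.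
    by have := homologous_cat (base _) (simplex_path s); rewrite simplex_pathK.
  - exists (cat_path p (rev_path q)).
    have -> : c - d - cone (boundary (c - d)) =
        (c - cone (boundary c)) - (d - cone (boundary d)).
      rewrite raddfB coneB /= !opprB addrACA [RHS]addrACA.
      by congr (_ + _); rewrite addrC.
    apply: homologous_trans (homologous_cat _ _).
    apply: homologousD => //; apply: homologous_trans (homologousN dq) _.
    exact/homologous_sym/homologous_rev.
elim/quotW: h => z; have [p zp] := main (val z).
exists (pi1_class p); rewrite hurewiczE; apply/homologous_classP/homologous_sym.
have := zp; rewrite (_ : boundary (val z) = 0); last exact/eqP/(valP z).
by rewrite cone0 subr0.
Qed.

Section Characters.
Variables (B : zmodType) (chi : pi1 R x0 -> B).
Hypothesis chiM : forall a b, chi (a * b)%g = chi a + chi b.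

(** Extends the character [chi] from loops at [x0] to all paths, as an additive function for
    concatenation. *)
Definition path_char x y (p : path R x y) : B := chi (pi1_class (based_loop p)).

Lemma path_char_homotopic x y (p q : path R x y) :
  homotopic p q -> path_char p = path_char q.
Proof.
move=> pq; congr (chi _); apply/pi1_classP.
by apply: homotopic_cat (homotopic_cat (homotopic_refl _) pq) (homotopic_refl _).
Qed.

Lemma homotopic_eqfun x y (p q : path R x y) : p =1 q -> homotopic p q.
Proof.
by move=> pq; apply: (@homotopic_reparam R X _ _ _ _ q id id) => //;
  exact: cts_id.
Qed.

(** Needed for paths whose end points are equal without being convertible, so that their types
    differ. *)
Lemma path_char_eq x y (x' y' : X) (p : path R x y) (q : path R x' y') :
  x = x' -> y = y' -> p =1 q -> path_char p = path_char q.
Proof.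
move=> xx' yy'; subst x' y' => pq.
exact/path_char_homotopic/homotopic_eqfun.
Qed.

(** In the product of the two based loops, [rev_path (base y)] is followed by [base y], and the two
    cancel up to homotopy. *)
Lemma path_char_cat x y z (p : path R x y) (q : path R y z) :
  path_char (cat_path p q) = path_char p + path_char q.
Proof.
rewrite /path_char -chiM; congr (chi _).
rewrite [RHS]pi1_mulE; apply/pi1_classP/homotopic_sym; rewrite /based_loop.
have cong := @homotopic_cat R X.
set rz := rev_path (base z); set ry := rev_path (base y).
apply: (@homotopic_trans _ _ _ _ _
  (cat_path (cat_path (base x) p) (cat_path q rz))).
  apply: homotopic_trans (homotopic_sym (cat_pathA _ _ _)) _.
  apply: (cong); first exact: homotopic_refl.
  apply: homotopic_trans (cat_pathA _ _ _) _.
  apply: (cong); last exact: homotopic_refl.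
  apply: homotopic_trans (cat_pathA _ _ _) _.
  apply: homotopic_trans (cat_cst_path q).
  by apply: (cong); [exact: cat_rev_path|exact: homotopic_refl].
apply: homotopic_trans (cat_pathA _ _ _) _.
by apply: (cong); [exact/homotopic_sym/cat_pathA|exact: homotopic_refl].
Qed.

Lemma chi1 : chi 1%g = 0.
Proof. by apply: (addIr (chi 1%g)); rewrite -chiM mulg1 add0r. Qed.

(** The loop [base x0] may be nontrivial, but its value and that of its reverse cancel because [B]
    is commutative. *)
Lemma path_char_loop (p : path R x0 x0) : path_char p = chi (pi1_class p).
Proof.
rewrite /path_char /based_loop -!pi1_mulE !chiM addrAC -chiM.
have -> : (pi1_class (base x0) * pi1_class (rev_path (base x0)))%g = 1%g.
  by rewrite [LHS]pi1_mulE; exact/pi1_classP/cat_path_rev.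
by rewrite chi1 add0r.
Qed.

Definition chain_char : chain R 1 X -> zmodule B :=
  fglift (fun s : sing R 1 X => path_char (simplex_path s) : zmodule B).

Lemma chain_char_zmod : zmod_morphism chain_char.
Proof. exact: lift_is_additive. Qed.

HB.instance Definition _ :=
  GRing.isZmodMorphism.Build _ _ chain_char chain_char_zmod.

Lemma chain_char1 (s : sing R 1 X) :
  chain_char << s >> = path_char (simplex_path s).
Proof. by rewrite /chain_char liftU scale1r. Qed.

(** Paths in a 2-simplex with the same ends are homotopic, so the value [W] of an edge depends only
    on its vertices and is additive along them. The alternating sum over the three edges is
    therefore zero. *)
Lemma chain_char_boundary (c : chain R 2 X) : chain_char (boundary c) = 0.
Proof.
elim/freeg_subgroup_ind: c => [|s|c d c0 d0].
- by rewrite !raddf0.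
- pose W a b := path_char (map_path s (line a b)).
  have Wcat a b d : W a b + W b d = W a d.
    rewrite /W -path_char_cat; apply: path_char_homotopic.
    apply: homotopic_trans (homotopic_sym (homotopic_map_cat _ _ _)) _.
    exact/homotopic_map/simplex_homotopic.
  have Wface i : chain_char << (s \o face i : sing R 1 X) >> =
      W (vertex R (fintype.lift i ord0)) (vertex R (fintype.lift i ord_max)).
    rewrite chain_char1.
    transitivity (path_char (map_path s (map_path (face i : continuousType _ _)
      (line (vertex R ord0) (vertex R ord_max))))).
      exact: path_char_eq.
    rewrite -!face_vertex; apply: path_char_homotopic.
    exact/homotopic_map/simplex_homotopic.
  rewrite /boundary liftU scale1r raddf_sum !big_ord_recl big_ord0 /=.
  rewrite !raddfZsign /= !Wface.
  rewrite expr0 expr1 expr2 mulN1r opprK !scale1r scaleN1r addr0.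
  rewrite addrCA addrC; apply/eqP; rewrite subr_eq0; apply/eqP.
  rewrite addrC -[RHS](Wcat _ (vertex R (fintype.lift ord0 ord0))).
  by congr (W (vertex R _) (vertex R _) + W (vertex R _) (vertex R _));
    exact: val_inj.
- by rewrite !raddfB /= c0 d0 subrr.
Qed.

(** The injectivity half of the Hurewicz theorem, in dual form: [chain_char] extends [chi] to chains
    and vanishes on boundaries, so [chi] factors through H_1. *)
Lemma hurewicz_char (a b : pi1 R x0) : hurewicz a = hurewicz b -> chi a = chi b.
Proof.
elim/pi1_ind: a => p; elim/pi1_ind: b => q.
rewrite !hurewiczE => /homologous_classP[e] /= ee.
have E (r : path R x0 x0) : chain_char << path_simplex r >> = chi (pi1_class r).
  rewrite chain_char1 -path_char_loop; apply: path_char_eq => [||t] /=;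
    rewrite /bary_coord /=.
  - by rewrite mxE /= path_le0.
  - by rewrite mxE /= path_ge1.
  rewrite /convex_comb_fun /= !mxE /= mulr0 mulr1 add0r.
  have [t0|t0] := lerP t 0; first by rewrite clamp_le0// !path_le0.
  have [t1|t1] := lerP 1 t; first by rewrite clamp_ge1// !path_ge1.
  by rewrite clamp_id// (ltW t0) (ltW t1).
apply/eqP; rewrite -subr_eq0 -!E -(raddfB chain_char) -ee.
exact/eqP/chain_char_boundary.
Qed.

End Characters.
End HurewiczTheorem.

(** * Path-connectedness of surfaces *)

Section SurfacePaths.
Variable R : realType.

Lemma complex_of_real_cts : continuous (@complex_of_real R).
Proof.
move=> x; apply/cvgrPdist_lt => e e0.
(* In the order of [R[i]], a positive number is real. *)
have eE : e = (complex.Re e)%:C%C.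
  by move: e0; case: (e : R[i]) => a b; rewrite ltcE /= => /andP[/eqP->].
have re0 : 0 < complex.Re e by move: e0; rewrite eE ltcR.
have : nbhs x (ball x (complex.Re e)) by exact: nbhsx_ballx.
apply: filterS => y; rewrite /ball /= => yx; rewrite /complex_of_real eE.
rewrite (_ : (x%:C)%C - (y%:C)%C = ((x - y)%:C)%C) ?rmorphB//.
by rewrite normc_def /= subrr expr0n addr0 sqrtr_sqr ltcR.
Qed.

Lemma nbhs_star_shaped (K : numFieldType) (z : K) (U : set K) : nbhs z U ->
  exists2 V : set K, nbhs z V &
    forall w s, V w -> 0 <= s <= 1 -> U (z + s * (w - z)).
Proof.
move=> /nbhs_ballP[e /= e0 zeU]; exists (ball z e); first exact: nbhsx_ballx.
move=> w s; rewrite /ball /= => zw /andP[s0 s1]; apply: zeU.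
rewrite /ball /= opprD addNKr normrN normrM (ger0_norm s0).
by apply: le_lt_trans zw; rewrite [X in _ <= X]distrC ler_piMl.
Qed.

(** For [y] near [x], the segment from [c x] to [c y] stays in the open image of the chart, and
    [chart_inv] pulls it back. *)
Lemma chart_path (X : topologicalType) (c : chart R X) (x : X) : chart_dom c x ->
  \forall y \near x, inhabited (path R x y).
Proof.
move=> cx; have img : nbhs (c x) (c @` chart_dom c).
  by apply: open_nbhs_nbhs; split; [exact: chart_img_open|exists x].
have [B nB star] := nbhs_star_shaped img.
have cc : {in chart_dom c, continuous c}.
  rewrite -continuous_open_subspace; last exact: chart_dom_open.
  exact: chart_map_cts.
have ci : {in c @` chart_dom c, continuous (chart_inv c)}.
  rewrite -continuous_open_subspace; last exact: chart_img_open.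
  exact: chart_inv_cts.
have nb : \forall y \near x, B (c y) by exact: (cc x (mem_set cx) _ nB).
have nd : \forall y \near x, chart_dom c y.
  by apply: open_nbhs_nbhs; split; [exact: chart_dom_open|].
apply: filterS2 nb nd => y yb yd.
pose g (t : R) : CC R := c x + complex_of_real (clamp t) * (c y - c x).
have gc : continuous g.
  move=> t; apply: cvgD; first exact: cvg_cst.
  apply: cvgM; last exact: cvg_cst.
  by apply: cts_comp; [exact: complex_of_real_cts|exact: clamp_cts].
have gb t : (c @` chart_dom c) (g t).
  apply: star => //; have /andP[t0 t1] := clamp01 t.
  rewrite -[0](rmorph0 (real_complex R)) -[1](rmorph1 (real_complex R)).
  by rewrite !lecR t0.
constructor; apply: (@Path R X x y (fun t => chart_inv c (g t))).
- move=> t; apply: continuous_comp; first exact: gc.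
  by apply: ci; apply/mem_set/gb.
- move=> t t0; rewrite /g clamp_le0// mul0r addr0.
  exact: chart_mapK.
- move=> t t0; rewrite /g clamp_ge1// mul1r addrC subrK.
  exact: chart_mapK.
Qed.

(** Local path-connectedness makes the path component of [x0] both open and closed, and the surface
    is connected. *)
Lemma surface_path (S : closedRiemannSurface R) (x0 x : S) :
  inhabited (path R x0 x).
Proof.
have near_path (y : S) : \forall z \near y, inhabited (path R y z).
  by have [c [_ cy]] := atlas_cover y; exact: chart_path cy.
pose D := [set y : S | inhabited (path R x0 y)].
have oD : open D.
  rewrite openE => y [p]; apply: filterS (near_path y) => z [q].
  by constructor; exact: cat_path p q.
have cD : closed D.
  rewrite -openC openE => y nDy.
  apply: filterS (near_path y) => z [q] [p]; apply: nDy.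
  by constructor; exact: cat_path p (rev_path q).
suff : D = setT by move=> DT; have : D x by rewrite DT.
apply: (@surface_connected R S).
- by exists x0; constructor; exact: cst_path.
- by exists D => //; rewrite setTI.
- by exists D => //; rewrite setTI.
Qed.

End SurfacePaths.

(** * Homology classes orthogonal to V *)

(** The Smith normal form of the coordinate vector of [x] provides a basis, the rows of an
    invertible matrix [M], whose first vector [y] divides [x]; [phi] is the coordinate along [y]. *)
Lemma primitive_functional (H : zmodType) n (u : {additive 'rV[int]_n -> H})
    (x : H) : bijective u -> x <> 0 ->
  exists (y : H) (k : int) (phi : H -> int),
    [/\ x = y *~ k, forall a b, phi (a + b) = phi a + phi b & phi y = 1].
Proof.
case: n u => [|n] u [v uK vK] x0.
  by case: x0; rewrite -(vK x) (thinmx0 (v x)) raddf0.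
have [L _ [M Mu [d _ vE]]] := int_Smith_normal_form (v x).
pose k : int := L ord0 ord0 * d`_0.
exists (u (row ord0 M)), k, (fun h => (v h *m invmx M) ord0 ord0).
split=> [|a b|].
- rewrite -raddfMz -[LHS]vK; congr (u _).
  rewrite vE -scaler_int intz rowE scalemxAl.
  congr (_ *m _); apply/rowP => j; rewrite !mxE big_ord1 !mxE eqxx /k.
  have -> : (j == ord0) = ((ord0 : 'I_1) == j :> nat) by rewrite eq_sym.
  by case: (_ == _ :> nat); rewrite ?mulr1n ?mulr1 ?mulr0n ?mulr0.
- have -> : v (a + b) = v a + v b by apply: (can_inj uK); rewrite raddfD !vK.
  by rewrite mulmxDl mxE.
- by rewrite uK -row_mul mulmxV// !mxE eqxx.
Qed.

Section OrthogonalComplement.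
Variables (R : realType) (S : closedRiemannSurface R).
Variable omega : homology1 R S -> homology1 R S -> int.
Hypothesis form : intersection_form omega.
Variable V : set (homology1 R S).

Lemma formBl x y z : omega (x - y) z = omega x z - omega y z.
Proof. by apply/eqP; rewrite eq_sym subr_eq -(form_addl form) subrK. Qed.

Lemma formMzl x z k : omega (x *~ k) z = omega x z * k.
Proof.
have add : zmod_morphism (omega ^~ z) by move=> a b; exact: formBl.
pose f : {additive _ -> _} := HB.pack (omega ^~ z)
  (GRing.isZmodMorphism.Build _ _ _ add).
by rewrite -[LHS]/(f (x *~ k)) raddfMz /= mulrzz.
Qed.

(** Take [x] outside [V] and subtract its orthogonal projection [v], which exists by
    unimodularity. *)
Lemma orthogonal_neq0 : symplectic_subspace omega V -> V <> setT ->
  exists2 x, orthogonal omega V x & x <> 0.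
Proof.
move=> [[_ VB] _ uni] VT.
have [x Vx] : exists x, ~ V x.
  by apply/existsNP => VA; apply: VT; apply/seteqP; split=> x.
have [|v Vv xv] := uni (omega x); first by move=> *; exact: form_addr.
exists (x - v) => [w Vw|]; first by rewrite formBl xv// subrr.
by move/eqP; rewrite subr_eq0 => /eqP xE; apply: Vx; rewrite xE.
Qed.

(** The form takes values in Z, which has no torsion, and [k] is not 0. *)
Lemma orthogonal_divisible x y k : x = y *~ k -> x <> 0 ->
  orthogonal omega V x -> orthogonal omega V y.
Proof.
move=> xE x0 ox v Vv; have := ox v Vv; rewrite xE formMzl => /eqP.
rewrite mulf_eq0 => /orP[/eqP//|/eqP k0].
by case: x0; rewrite xE k0 mulr0z.
Qed.

End OrthogonalComplement.

(** * Algebraic groups and representations *)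

Section GeneratedSubalgebras.
Variables (K : fieldType) (T : Type) (gens : set (T -> K)).

Lemma gen_subalg_sum (I : Type) (r : seq I) (P : pred I) (F : I -> T -> K) :
  (forall i, gen_subalg gens (F i)) ->
  gen_subalg gens (fun x => \sum_(i <- r | P i) F i x).
Proof.
move=> gF; elim: r => [|i r IH].
  by under eq_fun do rewrite big_nil; exact: Gen_cst.
under eq_fun do rewrite big_cons.
by case: (P i) => //; exact: Gen_add.
Qed.

Lemma gen_subalg_prod (I : Type) (r : seq I) (P : pred I) (F : I -> T -> K) :
  (forall i, gen_subalg gens (F i)) ->
  gen_subalg gens (fun x => \prod_(i <- r | P i) F i x).
Proof.
move=> gF; elim: r => [|i r IH].
  by under eq_fun do rewrite big_nil; exact: Gen_cst.
under eq_fun do rewrite big_cons.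
by case: (P i) => //; exact: Gen_mul.
Qed.

Lemma gen_subalg_comp (T' : Type) (gens' : set (T' -> K)) (u : T -> T')
    (f : T' -> K) :
  (forall h, gens' h -> gen_subalg gens (h \o u)) ->
  gen_subalg gens' f -> gen_subalg gens (f \o u).
Proof.
move=> gu; elim=> [c|h /gu//|h k _ IHh _ IHk|h k _ IHh _ IHk].
- exact: Gen_cst.
- exact: Gen_add.
- exact: Gen_mul.
Qed.

End GeneratedSubalgebras.

Section AlgebraicGroupTheory.
Variable K : fieldType.

Lemma ag_idempotent n (G : alg_group K n) g : G g -> g *m g = g -> g = 1%:M.
Proof. by move=> /ag_unit gu gg; rewrite -[LHS](mulmxK gu) gg mulmxV. Qed.

Lemma alg_morphism1 m n (G : alg_group K m) (H : alg_group K n) phi :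
  alg_morphism G H phi -> phi 1%:M = 1%:M.
Proof.
move=> [GH phiM _]; apply: (@ag_idempotent _ H); first exact/GH/ag_1.
by rewrite -phiM ?mulmx1//; exact: ag_1.
Qed.

(* Otherwise the identity of [A] and the trivial morphism would both factor   *)
(* [ab] through [A].                                                          *)
Lemma abelianisation_nontrivial m n (G : alg_group K m) (A : alg_group K n) ab :
  abelianisation G A ab -> dim_ge (ag_set A) 1 ->
  exists2 g, G g & ab g <> 1%:M.
Proof.
move=> [AC abm abU] [c [cA cS]].
have [/existsNP[g /not_implyP[Gg abg]]|] :=
  pselect (~ forall g, G g -> ab g = 1%:M); first by exists g.
move=> /contrapT ab1; exfalso.
have idm : alg_morphism A A id.
  split=> // i j; exists (fun g => g i j) => //.
  by apply: Gen_gen; left; exists i, j.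
have onem : alg_morphism A A (fun=> 1%:M).
  split=> [a _|a b _ _|i j]; [exact: ag_1|by rewrite mulmx1|].
  by exists (fun=> 1%:M i j) => //; exact: Gen_cst.
have [chi _ chiU] := abU _ A ab AC abm.
have A1 a : A a -> a = 1%:M.
  move=> Aa; rewrite (chiU _ idm _ _ Aa)//.
  by rewrite -(chiU _ onem _ _ Aa)// => g /ab1.
(* A group with one element has no strict chain of two nonempty subsets. *)
have [_ [[a0 ca0] _] c0A] := cA 0%N isT.
have [_ _ c1A] := cA 1%N isT.
have [_] := cS 0%N isT; apply => a c1a.
by rewrite (A1 _ (c1A _ c1a)) -(A1 _ (c0A _ ca0)).
Qed.

Section AbelianGroupElements.
Variables (n : nat) (A : alg_group K n) (AC : commutative_group A).

(* The dummy abstraction makes commutativity an argument of the type, as its  *)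
(* Zmodule instance (with matrix product as addition) needs it.               *)
Definition ag_elt : Type :=
  (fun _ : commutative_group A => {x : 'M[K]_n | `[< A x >]}) AC.
HB.instance Definition _ := Choice.on ag_elt.

Definition ag_elt_of x (Ax : A x) : ag_elt := exist _ x (asboolT Ax).

Lemma ag_eltP (x : ag_elt) : A (val x). Proof. exact/asboolP/(valP x). Qed.

Definition ag_elt_mul (x y : ag_elt) :=
  ag_elt_of (ag_mul (ag_eltP x) (ag_eltP y)).
Definition ag_elt_inv (x : ag_elt) := ag_elt_of (ag_inv (ag_eltP x)).

Lemma ag_elt_mulA : associative ag_elt_mul.
Proof. by move=> x y z; apply: val_inj; rewrite /= mulmxA. Qed.

Lemma ag_elt_mulC : commutative ag_elt_mul.
Proof. by move=> x y; apply: val_inj; apply: AC; exact: ag_eltP. Qed.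

Lemma ag_elt_mul1 : left_id (ag_elt_of (ag_1 A)) ag_elt_mul.
Proof. by move=> x; apply: val_inj; rewrite /= mul1mx. Qed.

Lemma ag_elt_mulV : left_inverse (ag_elt_of (ag_1 A)) ag_elt_inv ag_elt_mul.
Proof.
by move=> x; apply: val_inj; rewrite /= mulVmx// (ag_unit (ag_eltP x)).
Qed.

HB.instance Definition _ :=
  GRing.isZmodule.Build ag_elt ag_elt_mulA ag_elt_mulC ag_elt_mul1 ag_elt_mulV.

End AbelianGroupElements.

Section Representations.
Variables (n : nat) (G : alg_group K n) (Pi : groupType).
Implicit Type rho : rep G Pi.

Lemma rep1 rho : rho 1%g = 1%:M.
Proof.
by apply: (@ag_idempotent _ G); [exact: rep_in|rewrite -rep_mul mulg1].
Qed.

Lemma repV rho a : rho a^-1%g = invmx (rho a).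
Proof.
have u := ag_unit (rep_in rho a).
by rewrite -[LHS](mulmxK u) -rep_mul mulVg rep1 mul1mx.
Qed.

(** The one generator that is not an entry, the inverse determinant, is the determinant of
    [rho a^-1], a polynomial in entries. *)
Lemma rep_coord_regular a f : regular_fun f ->
  rep_coord (fun rho : rep G Pi => f (rho a)).
Proof.
move=> fr; apply: (gen_subalg_comp (u := fun rho : rep G Pi => rho a)) fr.
have entry b i j : rep_coord (fun rho : rep G Pi => rho b i j).
  by apply: Gen_gen; exists b, i, j.
move=> h [[i [j ->]]|->]; first exact: entry.
have -> : (fun g : 'M[K]_n => (\det g)^-1) \o (fun rho : rep G Pi => rho a) =
    (fun rho : rep G Pi => \det (rho a^-1)%g).
  by apply/funext => rho /=; rewrite repV det_inv.
apply: gen_subalg_sum => s; apply: Gen_mul; first exact: Gen_cst.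
by apply: gen_subalg_prod => i; exact: entry.
Qed.

(** The representation factors through Z: it sends [a] to [g ^ phi a]. *)
Lemma power_rep (phi : Pi -> int) g : G g ->
  (forall a b, phi (a * b)%g = phi a + phi b) ->
  exists rho : rep G Pi, forall a, phi a = 1 -> rho a = g.
Proof.
(* Integer powers are taken in the ring of matrices of positive size; in size 0 there is only one
   matrix. *)
move=> Gg phiM; case: n G g Gg => [|n'] G' g Gg.
  have gM (a b : Pi) : g = g *m g by rewrite [LHS]flatmx0 [RHS]flatmx0.
  by exists (Rep (fun=> Gg) gM).
have gu : g \is a GRing.unit := ag_unit Gg.
have gN k : G' (g ^ k).
  have pos l : G' (g ^+ l).
    by elim: l => [|l IH]; [exact: ag_1|rewrite exprS; exact: ag_mul].
  case: k => l; first exact: pos.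
  have -> : g ^ Negz l = invmx (g ^+ l.+1) by [].
  exact/ag_inv/pos.
have gM a b : g ^ phi (a * b)%g = g ^ phi a *m g ^ phi b.
  by rewrite phiM exprzDr.
by exists (Rep (fun a => gN (phi a)) gM) => a /= ->; rewrite expr1z.
Qed.

Section Abelianisation.
Variables (m : nat) (A : alg_group K m) (ab : 'M[K]_n -> 'M[K]_m).
Hypotheses (AC : commutative_group A) (abm : alg_morphism G A ab).

(** Conjugation by [g] becomes trivial after [ab], because [A] is commutative. *)
Lemma char_coord_ab a i j :
  char_coord (fun rho : rep G Pi => ab (rho a) i j).
Proof.
have [GA abM abr] := abm; split=> [|g Gg rho /=].
  have [f fr fE] := abr i j.
  rewrite (_ : (fun _ => _) = fun rho : rep G Pi => f (rho a)).
    exact: rep_coord_regular.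
  by apply/funext => rho; rewrite fE//; exact: rep_in.
have Gi := ag_inv Gg; have Ga := rep_in rho a.
rewrite !abM//; last exact: ag_mul.
rewrite (AC (GA _ Gg) (GA _ Ga)) -mulmxA -abM// mulmxV ?(ag_unit Gg)//.
by rewrite (alg_morphism1 abm) mulmx1.
Qed.

End Abelianisation.
End Representations.
End AlgebraicGroupTheory.

(** * An invariant function from the abelianisation *)

Theorem proposition1p7 (R : realType) (S : closedRiemannSurface R) (g : nat)
    (x0 : S) (n m : nat) (G : alg_group (CC R) n) (A : alg_group (CC R) m)
    (ab : 'M[CC R]_n -> 'M[CC R]_m) (Gamma : set (continuousType S S))
    (omega : homology1 R S -> homology1 R S -> int) (V : set (homology1 R S)) :
  has_genus S g -> (1 <= g)%N ->
  reductive G -> abelianisation G A ab -> dim_ge (ag_set A) 1 ->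
  mcg_subgroup Gamma ->
  intersection_form omega ->
  symplectic_subspace omega V -> V <> [set: homology1 R S] ->
  (forall f : continuousType S S, Gamma f ->
     SpV omega V (homology_map (R := R) f)) ->
  (exists q : ratfun G (pi1 R x0),
     ratfun_invariant Gamma q /\ ~ ratfun_constant q) /\
  (forall x : char_point G (pi1 R x0), ~ zariski_dense (mcg_orbit Gamma x)).
Proof.
move=> [u ub] _ _ abG dA _ form sympV VT GSp.
have [AC abm _] := abG; have [GA abM _] := abm.
have [x ox xn0] := orthogonal_neq0 form sympV VT.
have [y [k [phi [xE phiD phiy]]]] := primitive_functional ub xn0.
have oy := orthogonal_divisible form xE xn0 ox.
have based z : exists _ : path R x0 z, True.
  by have [p] := surface_path x0 z; exists p.
pose base z := projT1 (cid (based z)).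
have [a ha] := hurewicz_surj base y.
have [h Gh abh] := abelianisation_nontrivial abG dA.
(* The same entry of [ab (rho a)] will be the invariant function [F]. *)
have [i [j hij]] : exists i j, ab h i j <> (1%:M : 'M[CC R]_m) i j.
  apply: contrapT => eqab; apply: abh; apply/matrixP => i j.
  by apply: contrapT => neq; apply: eqab; exists i, j.
pose F (rho : rep G (pi1 R x0)) := ab (rho a) i j.
have FC : char_coord F by exact: (char_coord_ab AC abm).
have Finv (f : continuousType S S) (w : path R x0 (f x0)) :
    Gamma f -> mcg_pull w F = F.
  move=> Gf; apply/funext => rho.
  (* A character of pi_1 with values in [A], written additively. It agrees on [a] and on its image
     under [f], since both have the class [y], which [f] fixes. *)
  pose chi b : ag_elt AC := ag_elt_of AC (GA _ (rep_in rho b)).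
  have chiM b c : chi (b * c)%g = chi b + chi c.
    by apply: val_inj; rewrite /= rep_mul abM//; exact: rep_in.
  have /(congr1 val) /= abE : chi (pi1_map w a) = chi a.
    apply: (hurewicz_char base chiM); rewrite hurewicz_natural ha.
    by have [_ _ ->] := GSp f Gf.
  by rewrite /mcg_pull /F /= abE.
pose psi (b : pi1 R x0) := phi (hurewicz b).
have psiM b c : psi (b * c)%g = psi b + psi c by rewrite /psi hurewiczM phiD.
have psia : psi a = 1 by rewrite /psi ha.
have Fnc c : ~ forall rho, F rho = c.
  move=> Fc; apply: hij.
  (* [rho] sends [a] to [h] and [tau] sends [a] to the identity, so [F] takes different values at
     them. *)
  have [rho /(_ a psia) rhoE] := power_rep Gh psiM.
  have [tau /(_ a psia) tauE] := power_rep (ag_1 G) psiM.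
  by rewrite -rhoE -/(F rho) Fc -(Fc tau) /F tauE (alg_morphism1 abm).
have cstC (c : CC R) : char_coord (fun _ : rep G (pi1 R x0) => c).
  by split=> //; exact: Gen_cst.
split.
- have one_reg (E : rep G (pi1 R x0) -> CC R) : char_coord E ->
      (forall rho, E rho * 1 = 0) -> forall rho, E rho = 0.
    by move=> _ E0 rho; rewrite -[LHS]mulr1.
  exists (RatFun FC (cstC 1) one_reg); split=> [f w Gf rho|[c Fc]].
    by rewrite /= Finv.
  by apply: (Fnc c) => rho; have := Fc rho; rewrite /= !mulr1.
- move=> pt dense; apply: (Fnc (pt F)) => rho.
  (* The representation [rho] is itself a point of the quotient. By invariance [F - pt F] vanishes
     on the orbit of [pt], hence by density also at [ev]. *)
  pose ev := @CharPoint _ _ G (pi1 R x0) (fun E => E rho) (fun=> erefl)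
    (fun _ _ _ _ => erefl) (fun _ _ _ _ => erefl).
  have diffC : char_coord (fun rho' => F rho' + - pt F).
    split=> [|g' Gg' rho' /=]; last by rewrite FC.2.
    by apply: Gen_add; [exact: FC.1|exact: Gen_cst].
  apply/eqP; rewrite -subr_eq0; apply/eqP.
  apply: (dense _ diffC _ ev) => z [f [w [Gf zE]]].
  by rewrite point_add// point_cst zE// Finv// subrr.
Qed.
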